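(* Assume that the system $x(n+1)=A(n)x(n)$, $n\in\mathbb{N}$, is upper triangular, i.e. $A=(a_{ij})_{i,j=1,\dots,d}$ with $a_{ij}(n)=0$ for all $i>j$ and $n\in\mathbb{N}$, and let $A_{\mathrm{diag}}:=\operatorname{diag}(a_{11},\dots,a_{dd})$. Then $$\Sigma_{\mathrm{B}}(A)\subseteq\Sigma_{\mathrm{BD}}(A)\subseteq\Sigma_{\mathrm{ED}}(A),\qquad \Sigma_{\mathrm{B}}(A_{\mathrm{diag}})=\Sigma_{\mathrm{BD}}(A_{\mathrm{diag}})=\Sigma_{\mathrm{ED}}(A_{\mathrm{diag}}),$$ and $$\Sigma_{\mathrm{B}}(A)\subseteq\Sigma_{\mathrm{B}}(A_{\mathrm{diag}}),\qquad \Sigma_{\mathrm{BD}}(A)\subseteq\Sigma_{\mathrm{BD}}(A_{\mathrm{diag}}),\qquad \Sigma_{\mathrm{ED}}(A)=\Sigma_{\mathrm{ED}}(A_{\mathrm{diag}}).$$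
   Context: Here $\mathbb{N}=\{0,1,2,\dots\}$, $d\ge 1$, and $A=(A(n))_{n\in\mathbb{N}}$ is a Lyapunov sequence: each $A(n)\in\mathbb{R}^{d\times d}$ is invertible and both $(A(n))_{n\in\mathbb{N}}$ and $(A(n)^{-1})_{n\in\mathbb{N}}$ are bounded. For $x_0\in\mathbb{R}^d$, $x(\cdot,x_0)$ denotes the solution of $x(n+1)=A(n)x(n)$ with $x(0,x_0)=x_0$. The following notions are used for $A$ and, analogously, for any other Lyapunov sequence. For $x_0\neq 0$ the upper and lower Bohl exponents are $$\overline{\beta}_A(x_0)=\inf_{N\in\mathbb{N}}\ \sup_{n,m\in\mathbb{N},\,n-m>N}\frac{1}{n-m}\ln\frac{\|x(n,x_0)\|}{\|x(m,x_0)\|},\qquad \underline{\beta}_A(x_0)=\sup_{N\in\mathbb{N}}\ \inf_{n,m\in\mathbb{N},\,n-m>N}\frac{1}{n-m}\ln\frac{\|x(n,x_0)\|}{\|x(m,x_0)\|}.$$ The Bohl spectrum is $\Sigma_{\mathrm{B}}(A)=\bigcup_{x_0\in\mathbb{R}^d\setminus\{0\}}[\underline{\beta}_A(x_0),\overline{\beta}_A(x_0)]$. A system $x(n+1)=A(n)x(n)$ has a Bohl dichotomy if there exist subspaces $L_1,L_2\subseteq\mathbb{R}^d$ with $\mathbb{R}^d=L_1\oplus L_2$, $\alpha>0$ and functions $C_1,C_2:\mathbb{R}^d\to(0,\infty)$ such that $\|x(n,x_0)\|\le C_1(x_0)\mathrm{e}^{-\alpha(n-m)}\|x(m,x_0)\|$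 for all $x_0\in L_1$, $n\ge m$, and $\|x(n,x_0)\|\ge C_2(x_0)\mathrm{e}^{\alpha(n-m)}\|x(m,x_0)\|$ for all $x_0\in L_2$, $n\ge m$ ($n,m\in\mathbb{N}$). It has an exponential dichotomy if there exist subspaces $L_1,L_2\subseteq\mathbb{R}^d$ with $\mathbb{R}^d=L_1\oplus L_2$, $\alpha>0$ and a constant $K>0$ such that $\|x(n,x_0)\|\le K\mathrm{e}^{-\alpha(n-m)}\|x(m,x_0)\|$ for all $x_0\in L_1$, $n\ge m$, and $\|x(n,x_0)\|\ge K^{-1}\mathrm{e}^{\alpha(n-m)}\|x(m,x_0)\|$ for all $x_0\in L_2$, $n\ge m$. $\Sigma_{\mathrm{BD}}(A)$ (resp. $\Sigma_{\mathrm{ED}}(A)$) is the set of $\gamma\in\mathbb{R}$ for which $x(n+1)=\mathrm{e}^{-\gamma}A(n)x(n)$ has no Bohl dichotomy (resp. no exponential dichotomy). *)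

(* Defs.v *)
From HB Require Import structures.
From mathcomp Require Import all_boot all_order all_algebra.
From mathcomp Require Import all_classical all_reals all_analysis.

Set Implicit Arguments.
Unset Strict Implicit.
Unset Printing Implicit Defensive.

Import Order.TTheory GRing.Theory Num.Theory.
Import numFieldNormedType.Exports.

Local Open Scope classical_set_scope.
Local Open Scope ring_scope.

(* Vectors are columns ['cV[R]_d].  The norm [nu] used to measure them is a
   parameter: any norm on R^d is allowed, not only the sup norm that
   MathComp-Analysis attaches to matrices. *)
Definition is_norm (R : realType) (d : nat) (nu : 'cV[R]_d -> R) : Prop :=
  [/\ forall x, 0 <= nu x,
      forall x, nu x = 0 -> x = 0,
      forall (a : R) x, nu (a *: x) = `|a| * nu x
    & forall x y, nu (x + y) <= nu x + nu y].

(* [bounded_fun] refers to the library norm of matrices; since all norms on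
   R^(d x d) are equivalent, the choice is immaterial for boundedness. *)
Definition lyapunov_sequence (R : realType) (d : nat)
    (A : nat -> 'M[R]_d) : Prop :=
  [/\ forall n, A n \in unitmx,
      bounded_fun A
    & bounded_fun (fun n => invmx (A n))].

Fixpoint sol (R : realType) (d : nat) (A : nat -> 'M[R]_d) (x0 : 'cV[R]_d)
    (n : nat) : 'cV[R]_d :=
  if n is n'.+1 then A n' *m sol A x0 n' else x0.

Definition growth_rate (R : realType) (d : nat) (nu : 'cV[R]_d -> R)
    (A : nat -> 'M[R]_d) (x0 : 'cV[R]_d) (n m : nat) : R :=
  (n - m)%:R^-1 * ln (nu (sol A x0 n) / nu (sol A x0 m)).

(* The pairs (n, m) with n - m > N.  Truncated subtraction is harmless here:
   for n <= m both the integer and the natural condition fail. *)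
Definition far_apart (N : nat) : set (nat * nat) :=
  [set p | (N < p.1 - p.2)%N].

(* Infima and suprema are taken in the extended reals, so that they make sense
   with no boundedness side condition. *)
Definition upper_bohl (R : realType) (d : nat) (nu : 'cV[R]_d -> R)
    (A : nat -> 'M[R]_d) (x0 : 'cV[R]_d) : \bar R :=
  ereal_inf [set ereal_sup [set (growth_rate nu A x0 p.1 p.2)%:E
                           | p in far_apart N] | N in [set: nat]].

Definition lower_bohl (R : realType) (d : nat) (nu : 'cV[R]_d -> R)
    (A : nat -> 'M[R]_d) (x0 : 'cV[R]_d) : \bar R :=
  ereal_sup [set ereal_inf [set (growth_rate nu A x0 p.1 p.2)%:E
                           | p in far_apart N] | N in [set: nat]].

Definition bohl_spectrum (R : realType) (d : nat) (nu : 'cV[R]_d -> R)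
    (A : nat -> 'M[R]_d) : set R :=
  \bigcup_(x0 in [set x : 'cV[R]_d | x != 0])
    [set g : R | (lower_bohl nu A x0 <= g%:E <= upper_bohl nu A x0)%E].

Definition bohl_dichotomy (R : realType) (d : nat) (nu : 'cV[R]_d -> R)
    (A : nat -> 'M[R]_d) : Prop :=
  exists (L1 L2 : {vspace 'cV[R]_d}) (alpha : R) (C1 C2 : 'cV[R]_d -> R),
    [/\ (L1 + L2 = fullv)%VS /\ directv (L1 + L2),
        0 < alpha,
        forall x0, 0 < C1 x0 /\ 0 < C2 x0,
        forall x0, x0 \in L1 -> forall n m : nat, (m <= n)%N ->
          nu (sol A x0 n)
            <= C1 x0 * expR (- alpha * (n - m)%:R) * nu (sol A x0 m)
      & forall x0, x0 \in L2 -> forall n m : nat, (m <= n)%N ->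
          C2 x0 * expR (alpha * (n - m)%:R) * nu (sol A x0 m)
            <= nu (sol A x0 n)].

Definition exponential_dichotomy (R : realType) (d : nat) (nu : 'cV[R]_d -> R)
    (A : nat -> 'M[R]_d) : Prop :=
  exists (L1 L2 : {vspace 'cV[R]_d}) (alpha K : R),
    [/\ (L1 + L2 = fullv)%VS /\ directv (L1 + L2),
        0 < alpha,
        0 < K,
        forall x0, x0 \in L1 -> forall n m : nat, (m <= n)%N ->
          nu (sol A x0 n)
            <= K * expR (- alpha * (n - m)%:R) * nu (sol A x0 m)
      & forall x0, x0 \in L2 -> forall n m : nat, (m <= n)%N ->
          K^-1 * expR (alpha * (n - m)%:R) * nu (sol A x0 m)
            <= nu (sol A x0 n)].

Definition shifted (R : realType) (d : nat) (A : nat -> 'M[R]_d) (g : R) :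
    nat -> 'M[R]_d :=
  fun n => expR (- g) *: A n.

Definition bohl_dichotomy_spectrum (R : realType) (d : nat)
    (nu : 'cV[R]_d -> R) (A : nat -> 'M[R]_d) : set R :=
  [set g | ~ bohl_dichotomy nu (shifted A g)].

Definition exponential_dichotomy_spectrum (R : realType) (d : nat)
    (nu : 'cV[R]_d -> R) (A : nat -> 'M[R]_d) : set R :=
  [set g | ~ exponential_dichotomy nu (shifted A g)].

Definition upper_triangular (R : realType) (d : nat)
    (A : nat -> 'M[R]_d) : Prop :=
  forall (n : nat) (i j : 'I_d), (j < i)%N -> A n i j = 0.

Definition diag_part (R : realType) (d : nat) (A : nat -> 'M[R]_d) :
    nat -> 'M[R]_d :=
  fun n => diag_mx (\row_i A n i i).

(* Main.v *)
(* An upper triangular system has an exponential dichotomy exactly when each of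
   the scalar equations on its diagonal is uniformly contracting or uniformly
   expanding.  The bridge is Perron's admissibility property: every forcing of
   finite support and size at most 1 has a solution bounded by a fixed constant.
   Admissibility and exponential dichotomy are equivalent for invertible bounded
   systems.  If all diagonal equations are dichotomic, back substitution gives
   admissibility.  Conversely, admissibility passes to the lower-right blocks,
   where the first coordinate axis is invariant, and in a system with a Bohl
   dichotomy every single solution is contracting or expanding.  Finally, a
   solution x of A satisfies this for the system shifted by g exactly when g is
   outside its Bohl interval, so for the diagonal system the coordinate axes
   detect the whole dichotomy spectrum. *)

Require Import Defs.
From mathcomp Require Import all_boot all_order all_algebra.
From mathcomp Require Import all_classical all_reals all_analysis.
From mathcomp Require Import ring lra.

Set Implicit Arguments.
Unset Strict Implicit.
Unset Printing Implicit Defensive.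

Import Order.TTheory GRing.Theory Num.Theory.
Import numFieldNormedType.Exports.

Local Open Scope classical_set_scope.
Local Open Scope ring_scope.

(** * Norms on column vectors *)

Section Norms.

Variables (R : realType) (d : nat) (nu : 'cV[R]_d -> R).
Hypothesis nuP : is_norm nu.

Lemma norm_ge0 x : 0 <= nu x. Proof. by case: nuP. Qed.

Lemma norm_scale a x : nu (a *: x) = `|a| * nu x. Proof. by case: nuP. Qed.

Lemma norm_add x y : nu (x + y) <= nu x + nu y. Proof. by case: nuP. Qed.

Lemma norm_zero : nu 0 = 0.
Proof. by rewrite -(scale0r 0) norm_scale normr0 mul0r. Qed.

Lemma norm_opp x : nu (- x) = nu x.
Proof. by rewrite -scaleN1r norm_scale normrN1 mul1r. Qed.

Lemma norm_sub x y : nu (x - y) <= nu x + nu y.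
Proof. by rewrite -(norm_opp y) norm_add. Qed.

Lemma norm_gt0 x : x != 0 -> 0 < nu x.
Proof.
move=> x0; rewrite lt_neqAle norm_ge0 andbT eq_sym.
by apply: contra x0 => /eqP nx0; case: nuP => _ h _ _; apply/eqP/h.
Qed.

Lemma norm_sum (I : Type) (s : seq I) (P : pred I) (F : I -> 'cV[R]_d) :
  nu (\sum_(i <- s | P i) F i) <= \sum_(i <- s | P i) nu (F i).
Proof.
elim/big_rec2: _ => [|i y x _ h]; first by rewrite norm_zero.
by rewrite (le_trans (norm_add _ _))// lerD2l.
Qed.

Lemma col_sum_delta (x : 'cV[R]_d) : x = \sum_i x i 0 *: delta_mx i 0.
Proof.
rewrite {1}[x]matrix_sum_delta; apply: eq_bigr => i _.
by rewrite big_ord1.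
Qed.

Lemma norm_le_entries : exists2 c : R, 0 < c &
  forall (x : 'cV[R]_d) b, 0 <= b -> (forall i, `|x i 0| <= b) -> nu x <= c * b.
Proof.
exists (1 + \sum_i nu (delta_mx i 0)).
  by rewrite ltr_pwDl// sumr_ge0// => i _; exact: norm_ge0.
move=> x b b0 xb; rewrite {1}[x]col_sum_delta (le_trans (norm_sum _ _ _))//.
rewrite mulrDl mul1r mulr_suml ler_wpDl// ler_sum// => i _.
by rewrite norm_scale mulrC ler_wpM2l// norm_ge0.
Qed.

Lemma entry_le_mx_norm m n (x : 'M[R]_(m, n)) i j : `|x i j| <= `|x|.
Proof.
rewrite [leRHS]/Num.norm /= mx_normrE.
exact: (le_bigmax _ (fun ij : 'I_m * 'I_n => `|x ij.1 ij.2|) (i, j)).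
Qed.

(* On the unit sphere of the sup norm, [nu] attains a positive minimum. *)
Lemma entry_le_norm : exists2 c : R, 0 < c &
  forall (x : 'cV[R]_d) i, `|x i 0| <= c * nu x.
Proof.
(* Without an index the claim is vacuous; otherwise [i0] shows that the unit sphere is nonempty. *)
have [i0 _|d0] := pickP 'I_d; last by exists 1 => // x i; have := d0 i.
have [c c0 cP] := norm_le_entries.
pose f (v : 'rV[R]_d) := nu v^T.
pose S := [set v : 'rV[R]_d | `|v| = 1].
(* The reverse triangle inequality for [nu] and the bound of [nu] by the entries make [f] Lipschitz
   for the sup norm. *)
have fc : continuous f.
  move=> v; apply/(@cvgrPdist_le _ _ _ (nbhs v) (nbhs_filter v)) => e e0.
  have ec : 0 < e / c by rewrite divr_gt0.
  near=> u.
  have vu : `|v - u| <= e / c.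
    near: u; apply/nbhs_ballP; exists (e / c) => //= w.
    by rewrite -ball_normE /= => /ltW.
  have h w1 w2 : nu w1 - nu w2 <= nu (w1 - w2).
    by rewrite lerBlDr (le_trans _ (norm_add _ _))// subrK.
  have h2 w : `|w| <= e / c -> nu w^T <= e.
    move=> we; rewrite (le_trans (cP _ (e / c) (ltW ec) _))//.
      by move=> i; rewrite mxE (le_trans _ we)// entry_le_mx_norm.
    by rewrite mulrC divfK// gt_eqF.
  rewrite /f ler_norml -opprB lerN2 opprB; apply/andP; split.
    by rewrite (le_trans (h _ _))// -linearB h2// distrC.
  by rewrite (le_trans (h _ _))// -linearB h2.
have Sc : compact S.
  apply: bounded_closed_compact.
    by exists 1; split=> // M M1 v /= ->; exact: ltW.
  have -> : S = Num.norm @^-1` [set 1 : R] by [].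
  apply: closed_comp; last exact: closed_eq.
  by move=> v _; exact: norm_continuous.
have Sn v : v != 0 -> S (`|v|^-1 *: v).
  by move=> v0; rewrite /S /= normrZ normfV normr_id mulVf// normr_eq0.
have S0 : S !=set0.
  have d0 : (delta_mx 0 i0 : 'rV[R]_d) != 0.
    by apply/eqP => /matrixP/(_ 0 i0)/eqP; rewrite !mxE !eqxx/= oner_eq0.
  by eexists; exact: (Sn _ d0).
have [v vS vm] := EVT_min_rV S0 Sc (continuous_subspaceT fc).
have v0 : v != 0.
  apply/eqP => v0; move: vS.
  by rewrite inE /S /= v0 normr0 => /esym/eqP; rewrite oner_eq0.
have fv : 0 < f v.
  apply: norm_gt0; apply: contra v0 => /eqP/(congr1 trmx).
  by rewrite trmxK trmx0 => ->.
exists (f v)^-1; first by rewrite invr_gt0.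
move=> x i; have [->|x0] := eqVneq x 0.
  by rewrite mxE normr0 norm_zero mulr0.
have xT0 : x^T != 0 by apply: contra x0 => /eqP/(congr1 trmx); rewrite trmxK trmx0 => ->.
have : f v <= f (`|x^T|^-1 *: x^T) by apply: vm; rewrite inE; exact: Sn.
have xT : 0 < `|x^T| by rewrite normr_gt0.
rewrite /f linearZ/= trmxK norm_scale normfV normr_id ler_pdivlMl// => h.
rewrite ler_pdivlMl// (le_trans _ h)// [leLHS]mulrC ler_wpM2r//; first exact: ltW.
by have := entry_le_mx_norm x^T 0 i; rewrite mxE.
Unshelve. all: by end_near. Qed.

(** Since [a] depends on the entry bound only, it serves as one growth factor for all the matrices
    [A n]. The added 1 keeps it positive even for [M] equal to 0. *)
Lemma norm_mulmx_le M : 0 <= M -> exists2 a : R, 0 < a &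
  forall (A : 'M[R]_d), (forall i j, `|A i j| <= M) ->
  forall x, nu (A *m x) <= a * nu x.
Proof.
move=> M0; have [c c0 cP] := norm_le_entries; have [e e0 eP] := entry_le_norm.
exists (c * (M * e * d%:R + 1)).
  by rewrite mulr_gt0// ltr_wpDl// !mulr_ge0// ltW.
move=> A AM x; rewrite -mulrA; apply: cP.
  by rewrite mulr_ge0 ?norm_ge0// addr_ge0// !mulr_ge0// ltW.
move=> i; rewrite mxE (le_trans (ler_norm_sum _ _ _))//.
apply: (@le_trans _ _ (\sum_(j < d) M * e * nu x)).
  apply: ler_sum => j _; rewrite normrM -mulrA ler_pM//.
rewrite sumr_const card_ord -[leLHS]mulr_natr mulrDl mul1r.
by rewrite mulrAC lerDl norm_ge0.
Qed.

End Norms.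

(** * Exponential rates and homogeneous solutions *)

Section ExponentialRates.

Variable R : realType.
Implicit Types (w : nat -> R) (K q r : R).

(** The dichotomy estimates in multiplicative form, with [q] for exp(-alpha) and [h] for n - m. Here
    and in [expands] the decaying factor stands on the right, so the same [K] and [q] can serve
    both. *)
Definition contracts K q w := forall m h, w (m + h)%N <= K * q ^+ h * w m.

Definition expands K q w := forall m h, w m <= K * q ^+ h * w (m + h)%N.

Definition rate_constants K q := 0 < K /\ 0 < q < 1.

Definition contracting w := exists K q, rate_constants K q /\ contracts K q w.

Definition expanding w := exists K q, rate_constants K q /\ expands K q w.

Lemma perron_constants r : 0 < r -> rate_constants (1 + r) (r / (1 + r)).
Proof.
move=> r0; have r1 : 0 < 1 + r by rewrite addr_gt0.
by split=> //; rewrite divr_gt0//= ltr_pdivrMr// mul1r ltrDr.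
Qed.

(** The hypothesis bounds [S n.+1] by [r] times its last term, so passing from [S n.+1] back to
    [S n] loses a fixed proportion and [S n <= q * S n.+1]. Iterating, and comparing 1/[w m] with
    [S m] and [S (m + h)] with [r / w (m + h)], gives the decay. *)
Lemma sum_inv_contracts w r : 0 < r -> (forall n, 0 < w n) ->
  (forall n, w n * (\sum_(k < n.+1) (w k)^-1) <= r) ->
  contracts (1 + r) (r / (1 + r)) w.
Proof.
move=> r0 w0 wr; pose S n := \sum_(k < n.+1) (w k)^-1.
have [r1 /andP[q0 _]] := perron_constants r0; set q := r / (1 + r) in q0 *.
have Sr n : S n <= r / w n by rewrite ler_pdivlMr// mulrC wr.
have Sge n : (w n)^-1 <= S n.
  by rewrite /S big_ord_recr/= lerDr sumr_ge0// => i _; rewrite invr_ge0 ltW.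
have Sq n : S n <= q * S n.+1.
  have SS : S n.+1 = S n + (w n.+1)^-1 by rewrite /S big_ord_recr.
  rewrite /q mulrAC ler_pdivlMr// SS.
  have := Sr n.+1; rewrite SS => h.
  have : 0 < (w n.+1)^-1 by rewrite invr_gt0.
  move: h; generalize (S n) (w n.+1)^-1 => s t; lra.
have Sqh m h : S m <= q ^+ h * S (m + h)%N.
  elim: h => [|h ih]; first by rewrite expr0 mul1r addn0.
  by rewrite (le_trans ih)// addnS exprSr -mulrA ler_wpM2l// exprn_ge0// ltW.
move=> m h.
have : (w m)^-1 <= (1 + r) * q ^+ h / w (m + h)%N.
  rewrite (le_trans (Sge m))// (le_trans (Sqh m h))// [X in X * _^-1]mulrC -mulrA.
  rewrite ler_wpM2l ?exprn_ge0 ?(ltW q0)// (le_trans (Sr _))//.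
  by rewrite ler_wpM2r ?invr_ge0 ?lerDr// ltW.
by rewrite ler_pdivlMr// -ler_pdivlMl ?invr_gt0// invrK mulrC.
Qed.

(** The mirror image with tails: the first term of [T n] is at least [T n.+1 / r], so
    [T n.+1 <= q * T n], and the tails decay forwards. *)
Lemma sum_inv_expands w r : 0 < r -> (forall n, 0 < w n) ->
  (forall n N, w n * (\sum_(n.+1 <= k < N) (w k)^-1) <= r) ->
  expands (1 + r) (r / (1 + r)) w.
Proof.
move=> r0 w0 wr; have [r1 /andP[q0 _]] := perron_constants r0.
set q := r / (1 + r) in q0 *.
move=> m [|h]; first by rewrite expr0 mulr1 addn0 mulrDl mul1r lerDl mulr_ge0// ltW.
(* The cut-off makes 1/[w (m + h.+1)] the last term, so that [T (m + h)] is exactly this term. *)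
pose T n := \sum_(n.+1 <= k < (m + h).+2) (w k)^-1.
have Tr n : T n <= r / w n by rewrite ler_pdivlMr// mulrC wr.
have Tge0 n : 0 <= T n by rewrite sumr_ge0// => k _; rewrite invr_ge0 ltW.
have TS n : (n <= m + h)%N -> T n = (w n.+1)^-1 + T n.+1.
  by move=> nh; rewrite /T big_ltn.
have Tq n : T n.+1 <= q * T n.
  have [nh|nh] := leqP n (m + h); last first.
    by rewrite {1}/T big_geq; [rewrite mulr_ge0// ltW | rewrite !ltnS ltnW].
  rewrite /q mulrAC ler_pdivlMr// (TS n nh).
  by move: (Tr n.+1); generalize (T n.+1) (w n.+1)^-1 => s t; lra.
have Tqh i : T (m + i)%N <= q ^+ i * T m.
  elim: i => [|i ih]; first by rewrite expr0 mul1r addn0.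
  rewrite addnS (le_trans (Tq _))// exprS -mulrA ler_wpM2l//; exact: ltW.
have : (w (m + h.+1)%N)^-1 <= q ^+ h * (r / w m).
  apply: le_trans (_ : T (m + h)%N <= _).
    by rewrite /T big_nat1 addnS.
  by rewrite (le_trans (Tqh h))// ler_wpM2l// exprn_ge0// ltW.
have -> : (1 + r) * q ^+ h.+1 = q ^+ h * r.
  by rewrite exprS mulrA [_ * q]mulrC divfK ?gt_eqF// mulrC.
by rewrite mulrA ler_pdivlMr// ler_pdivrMl// [w _ * _]mulrC.
Qed.

Lemma contracting_scale (c : R) w : 0 < c ->
  contracting (fun n => w n * c) -> contracting w.
Proof.
move=> c0 [K [q [Kq h]]]; exists K, q; split=> // m k.
by have := h m k; rewrite mulrA ler_pM2r.
Qed.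

Lemma expanding_scale (c : R) w : 0 < c ->
  expanding (fun n => w n * c) -> expanding w.
Proof.
move=> c0 [K [q [Kq h]]]; exists K, q; split=> // m k.
by have := h m k; rewrite mulrA ler_pM2r.
Qed.

End ExponentialRates.

Section Solutions.

Variables (R : realType) (d : nat).
Implicit Types (A : nat -> 'M[R]_d) (x y : 'cV[R]_d).

Lemma solD A x y n : sol A (x + y) n = sol A x n + sol A y n.
Proof. by elim: n => //= n ->; rewrite mulmxDr. Qed.

Lemma solZ A a x n : sol A (a *: x) n = a *: sol A x n.
Proof. by elim: n => //= n ->; rewrite -scalemxAr. Qed.

Lemma solN A x n : sol A (- x) n = - sol A x n.
Proof. by rewrite -scaleN1r solZ scaleN1r. Qed.

Lemma solB A x y n : sol A (x - y) n = sol A x n - sol A y n.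
Proof. by rewrite solD solN. Qed.

Lemma sol_sum A (I : Type) (s : seq I) (P : pred I) (F : I -> 'cV[R]_d) n :
  sol A (\sum_(i <- s | P i) F i) n = \sum_(i <- s | P i) sol A (F i) n.
Proof.
apply: (big_morph (fun x => sol A x n)) => [x y|]; first exact: solD.
by rewrite -(scale0r 0) solZ !scale0r.
Qed.

Lemma sol_neq0 A x n : (forall n, A n \in unitmx) -> x != 0 -> sol A x n != 0.
Proof.
move=> Au x0; elim: n => //= n; apply: contraNneq => Ax.
by rewrite -(mulKmx (Au n) (sol A x n)) Ax mulmx0 eqxx.
Qed.

Lemma sol_surj A y n : (forall n, A n \in unitmx) -> exists x, sol A x n = y.
Proof.
move=> Au; elim: n y => [|n ih] y; first by exists y.
by have [x xE] := ih (invmx (A n) *m y); exists x; rewrite /= xE mulKVmx.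
Qed.

Lemma sol_shifted A g x n : sol (shifted A g) x n = expR (- g) ^+ n *: sol A x n.
Proof.
elim: n => [|n ih] /=; first by rewrite expr0 scale1r.
by rewrite ih /shifted -scalemxAl -scalemxAr scalerA exprS.
Qed.

Lemma sol_unique A x (y : nat -> 'cV[R]_d) :
  y 0 = x -> (forall n, y n.+1 = A n *m y n) -> forall n, y n = sol A x n.
Proof. by move=> y0 yS; elim=> [|n ih] //=; rewrite yS ih. Qed.

End Solutions.

(** * Dichotomies in terms of geometric rates *)

Section Dichotomies.

Variables (R : realType) (d : nat) (nu : 'cV[R]_d -> R).
Implicit Type A : nat -> 'M[R]_d.

Lemma exponential_dichotomyP A :
  exponential_dichotomy nu A <-> exists L1 L2 K q,
    [/\ (L1 + L2 = fullv)%VS /\ directv (L1 + L2), rate_constants K q,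
        forall x, x \in L1 -> contracts K q (nu \o sol A x)
      & forall x, x \in L2 -> expands K q (nu \o sol A x)].
Proof.
split=> [[L1 [L2 [a [K [L a0 K0 h1 h2]]]]]|[L1 [L2 [K [q [L [K0 /andP[q0 q1]] h1 h2]]]]]].
  exists L1, L2, K, (expR (- a)); split=> //.
  - by split=> //; rewrite expR_gt0 expR_lt1 oppr_lt0.
  - move=> x xL m h /=; have := h1 x xL (m + h)%N m (leq_addr _ _).
    by rewrite addKn expRM_natr.
  - move=> x xL m h /=; have := h2 x xL (m + h)%N m (leq_addr _ _).
    rewrite addKn expRM_natr -mulrA ler_pdivrMl//.
    rewrite -ler_pdivlMl ?exprn_gt0 ?expR_gt0// -exprVn -expRN.
    by rewrite mulrA [_ ^+ _ * K]mulrC.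
have qE : q = expR (ln q) by rewrite lnK.
exists L1, L2, (- ln q), K; split=> //.
- by rewrite oppr_gt0 ln_lt0// q0.
- move=> x xL n m mn; rewrite opprK expRM_natr -qE.
  by have := h1 x xL m (n - m)%N; rewrite /= subnKC.
- move=> x xL n m mn; rewrite expRM_natr expRN -qE.
  have := h2 x xL m (n - m)%N; rewrite /= subnKC// exprVn => h.
  by rewrite -mulrA ler_pdivrMl// ler_pdivrMl ?exprn_gt0// mulrCA mulrA.
Qed.

Lemma bohl_dichotomyW A : bohl_dichotomy nu A -> exists L1 L2 : {vspace 'cV[R]_d},
  [/\ (L1 + L2 = fullv)%VS,
      forall x, x \in L1 -> contracting (nu \o sol A x)
    & forall x, x \in L2 -> expanding (nu \o sol A x)].
Proof.
move=> [L1 [L2 [a [C1 [C2 [[L _] a0 C0 h1 h2]]]]]].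
have rate C : 0 < C -> rate_constants C (expR (- a)).
  by split=> //; rewrite expR_gt0 expR_lt1 oppr_lt0.
exists L1, L2; split=> // x xL; have [C10 C20] := C0 x.
- exists (C1 x), (expR (- a)); split; first exact: rate.
  move=> m h /=; have := h1 x xL (m + h)%N m (leq_addr _ _).
  by rewrite addKn expRM_natr.
- exists (C2 x)^-1, (expR (- a)); split; first by apply: rate; rewrite invr_gt0.
  move=> m h /=; have := h2 x xL (m + h)%N m (leq_addr _ _).
  rewrite addKn expRM_natr -mulrA -ler_pdivlMl//.
  rewrite -ler_pdivlMl ?exprn_gt0 ?expR_gt0// -exprVn -expRN.
  by rewrite mulrA [_ ^+ _ * _^-1]mulrC.
Qed.

Lemma exponential_bohl_dichotomy A :
  exponential_dichotomy nu A -> bohl_dichotomy nu A.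
Proof.
move=> [L1 [L2 [a [K [L a0 K0 h1 h2]]]]].
exists L1, L2, a, (fun=> K), (fun=> K^-1); split=> // x.
by rewrite invr_gt0.
Qed.

End Dichotomies.

(** Start from the zero space and adjoin vectors of [P] as long as one lies outside; [k] bounds the
    codimension, which drops at each extension. *)
Lemma vspace_of_closed (F : fieldType) (V : vectType F) (P : V -> Prop) :
  P 0 -> (forall a u v, P u -> P v -> P (a *: u + v)) ->
  exists U : {vspace V}, forall v, v \in U <-> P v.
Proof.
move=> P0 PD.
suff grow k (U : {vspace V}) : (\dim {:V} - \dim U <= k)%N ->
    (forall v, v \in U -> P v) -> exists U : {vspace V}, forall v, v \in U <-> P v.
  apply: (grow _ 0%VS (leqnn _)) => v; rewrite memv0 => /eqP->; exact: P0.
elim: k U => [|k ih] U Uk UP.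
  exists U => v; split; first exact: UP.
  move=> _; suff -> : U = fullv by rewrite memvf.
  by apply/eqP; rewrite eqEdim subvf/= -subn_eq0 -leqn0.
have [h|] := pselect (forall v, P v -> v \in U).
  by exists U => v; split; [exact: UP|exact: h].
move/existsNP => [v /not_implyP[Pv /negP vU]].
apply: (ih (U + <[v]>)%VS); last first.
  move=> w /memv_addP[u uU [w' /vlineP[a ->] ->]].
  by rewrite addrC; apply: PD => //; exact: UP.
have UV : (\dim U < \dim (U + <[v]>))%N.
  rewrite (ltn_leqif (dimv_leqif_sup (addvSl _ _))).
  apply: contra vU => /subvP; apply; apply: (subvP (addvSr _ _)); exact: memv_line.
by rewrite -ltnS; apply: leq_trans Uk; rewrite ltn_sub2l// (leq_trans UV)// dimvS// subvf.
Qed.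

(** * Admissibility implies exponential dichotomy *)

Definition forced_sol (R : realType) (d : nat) (A : nat -> 'M[R]_d)
    (f x : nat -> 'cV[R]_d) := forall n, x n.+1 = A n *m x n + f n.

(** [r] depends neither on [f] nor on the end [n0] of its support: Perron's argument cuts forcings
    off at arbitrarily late times and needs one bound for all of them. *)
Definition admissible (R : realType) (d : nat) (nu : 'cV[R]_d -> R)
    (A : nat -> 'M[R]_d) := exists2 r, 0 < r &
  forall f n0, (forall n, nu (f n) <= 1) -> (forall n, (n0 <= n)%N -> f n = 0) ->
  exists2 x, forced_sol A f x & forall n, nu (x n) <= r.

Section Perron.

Variables (R : realType) (d : nat) (nu : 'cV[R]_d -> R).
Hypothesis nuP : is_norm nu.
Variable A : nat -> 'M[R]_d.
Hypothesis Au : forall n, A n \in unitmx.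

Lemma forced_sol_sub f x y : forced_sol A f x -> forced_sol A f y ->
  forall n, x n - y n = sol A (x 0 - y 0) n.
Proof.
move=> fx fy; apply: (@sol_unique _ _ _ _ (fun n => x n - y n)) => // n.
by rewrite fx fy mulmxBr opprD addrACA subrr addr0.
Qed.

(** This space becomes the contracting subspace of the dichotomy. *)
Lemma bounded_solutions_vspace : exists L1 : {vspace 'cV[R]_d},
  forall v, v \in L1 <-> exists M, forall n, nu (sol A v n) <= M.
Proof.
apply: vspace_of_closed.
  by exists 0 => n; rewrite -(scale0r 0) solZ scale0r norm_zero.
move=> a u v [M uM] [N vN]; exists (`|a| * M + N) => n.
rewrite solD solZ (le_trans (norm_add nuP _ _))// lerD// norm_scale//.
by rewrite ler_wpM2l.
Qed.

Section Splitting.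

Variable L1 : {vspace 'cV[R]_d}.
Hypothesis L1P : forall v, v \in L1 <-> exists M, forall n, nu (sol A v n) <= M.

(** Each projected basis vector starts a bounded solution. There are finitely many of them, and the
    coordinates of [v] are controlled by [nu v], so linearity yields a uniform constant. *)
Lemma proj_bounded_solutions : exists2 c, 0 < c &
  forall v n, nu (sol A (projv L1 v) n) <= c * nu v.
Proof.
have [e e0 eP] := entry_le_norm nuP.
have /choice[M MP] (j : 'I_d) : exists M, forall n,
    nu (sol A (projv L1 (delta_mx j 0)) n) <= M.
  by apply/L1P; exact: memv_proj.
have M0 j : 0 <= M j by rewrite (le_trans _ (MP j 0%N))// norm_ge0.
exists (e * (1 + \sum_j M j)).
  by rewrite mulr_gt0// ltr_pwDl// sumr_ge0.
move=> v n; rewrite {1}[v]col_sum_delta linear_sum/= sol_sum.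
rewrite (le_trans (norm_sum nuP _ _ _))//.
rewrite mulrAC mulrDr mulr1 ler_wpDl ?mulr_ge0 ?norm_ge0 ?(ltW e0)//.
rewrite mulr_sumr ler_sum// => j _.
by rewrite linearZ/= solZ norm_scale// ler_pM// norm_ge0.
Qed.

(* Bounded solutions starting in the complement of [L1] are unique, so [s] bounds
   them for every finitely supported forcing of size at most 1. *)
Definition normalized_solution_bound s := forall f y n0,
  (forall n, nu (f n) <= 1) -> (forall n, (n0 <= n)%N -> f n = 0) ->
  forced_sol A f y -> y 0 \in (L1^C)%VS -> (exists M, forall n, nu (y n) <= M) ->
  forall n, nu (y n) <= s.

(** The admissible solution [x] and [y] differ by a bounded homogeneous solution, so [x 0 - y 0]
    lies in [L1]. As [y 0] is in the kernel of [projv L1], this difference is [projv L1 (x 0)], and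
    its solution costs at most [c * r]. *)
Lemma admissible_unique_bound : admissible nu A -> exists2 s, 0 < s &
  normalized_solution_bound s.
Proof.
move=> [r r0 adm]; have [c c0 cP] := proj_bounded_solutions.
exists (r + c * r); first by rewrite addr_gt0// mulr_gt0.
move=> f y n0 f1 fn0 fy yL [M yM] n; have [x fx xr] := adm f n0 f1 fn0.
have xyL : x 0 - y 0 \in L1.
  apply/L1P; exists (r + M) => k; rewrite -(forced_sol_sub fx fy).
  by rewrite (le_trans (norm_sub nuP _ _))// lerD.
have -> : y n = x n - sol A (projv L1 (x 0)) n.
  suff -> : projv L1 (x 0) = x 0 - y 0.
    by rewrite -(forced_sol_sub fx fy) subKr.
  rewrite -(projv_id xyL) linearB/=.
  have : y 0 \in lker (projv L1) by rewrite lker_proj.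
  by rewrite memv_ker => /eqP->; rewrite subr0.
rewrite (le_trans (norm_sub nuP _ _))// lerD// (le_trans (cP _ _))//.
by rewrite ler_wpM2l// ltW.
Qed.

(* Perron's trick: forcing along the normalized homogeneous solution [u] yields
   the solution [u n * sum_(k <= n) 1 / |u k|]; for [v] in the complement of
   [L1], the forward sum below plays the same role. *)
Lemma perron_contracts s c v : v \in L1 -> v != 0 ->
  normalized_solution_bound s ->
  (forall v n, nu (sol A (projv L1 v) n) <= c * nu v) ->
  forall n, nu (sol A v n) * (\sum_(k < n.+1) (nu (sol A v k))^-1) <= s + c.
Proof.
move=> vL v0 sP cP n; set u := sol A v; set w := fun n => nu (u n).
have w0 k : 0 < w k by apply: norm_gt0 => //; exact: sol_neq0.
(* A forcing at time k first acts at time k + 1, and the forced solution has to start at 0, so it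
   only produces the terms from index 1 on. The term of index 0 is bounded by [c]. *)
rewrite big_ord_recl mulrDr addrC lerD//; last first.
  by rewrite ler_pdivrMr; [have := cP v n; rewrite projv_id | exact: (w0 0%N)].
pose f k := if (k < n)%N then (w k.+1)^-1 *: u k.+1 else 0.
pose S k := \sum_(i < minn k n) (w i.+1)^-1.
have S0 k : 0 <= S k by apply: sumr_ge0 => i _; rewrite invr_ge0 ltW.
have -> : nu (sol A v n) * \sum_(i < n) (nu (u (lift ord0 i)))^-1 = nu (S n *: u n).
  by rewrite norm_scale// ger0_norm// mulrC /S minnn.
apply: (sP f (fun k => S k *: u k) n).
- move=> k; rewrite /f; case: ifP => _; last by rewrite norm_zero.
  rewrite norm_scale// ger0_norm ?invr_ge0 ?(ltW (w0 _))//.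
  by rewrite mulVf// gt_eqF// w0.
- by move=> k nk; rewrite /f ltnNge nk.
- move=> k; rewrite /f /S -scalemxAr -[A k *m u k]/(u k.+1).
  case: ltnP => kn.
    rewrite (minn_idPl kn).
    by rewrite big_ord_recr/= scalerDl.
  by rewrite (minn_idPr (leqW kn)) addr0.
- by rewrite /S min0n big_ord0 scale0r mem0v.
have /L1P[M vM] := vL.
exists ((\sum_(i < n) (w i.+1)^-1) * M) => k.
rewrite norm_scale// ger0_norm// ler_pM ?norm_ge0// /S.
rewrite -(big_mkord xpredT (fun i => (w i.+1)^-1)).
rewrite -(big_mkord xpredT (fun i => (w i.+1)^-1)).
rewrite [leRHS](@big_cat_nat _ _ _ (minn k n)) ?geq_minr//=.
by rewrite lerDl sumr_ge0// => i _; rewrite invr_ge0 ltW.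
Qed.

Lemma perron_expands s v : v \in (L1^C)%VS -> v != 0 ->
  normalized_solution_bound s ->
  forall n N, nu (sol A v n) * (\sum_(n.+1 <= k < N) (nu (sol A v k))^-1) <= s.
Proof.
move=> vL v0 sP n N; set u := sol A v; set w := fun n => nu (u n).
have w0 k : 0 < w k by apply: norm_gt0 => //; exact: sol_neq0.
(* The tail [T k] loses the term 1/[w k.+1] at each step, whence the minus sign. Stopping at [N]
   makes the solution vanish from there on, hence bounded although [u] may grow. *)
pose f k := if (k.+1 < N)%N then - (w k.+1)^-1 *: u k.+1 else 0.
pose T k := \sum_(k.+1 <= i < N) (w i)^-1.
have T0 k : 0 <= T k by apply: sumr_ge0 => i _; rewrite invr_ge0 ltW.
have TN k : (N <= k.+1)%N -> T k = 0 by move=> Nk; rewrite /T big_geq.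
have -> : nu (u n) * \sum_(n.+1 <= k < N) (nu (u k))^-1 = nu (T n *: u n).
  by rewrite norm_scale// ger0_norm// mulrC.
apply: (sP f (fun k => T k *: u k) N).
- move=> k; rewrite /f; case: ifP => _; last by rewrite norm_zero.
  rewrite norm_scale// normrN ger0_norm ?invr_ge0 ?(ltW (w0 _))// mulVf//.
  by rewrite gt_eqF.
- by move=> k nk; rewrite /f ltnNge (leqW nk).
- move=> k; rewrite /f -scalemxAr -[A k *m u k]/(u k.+1).
  case: ltnP => kn; last by rewrite !TN ?(leqW kn)// !scale0r addr0.
  by rewrite /T [in X in X *: _ + _]big_ltn// -scalerDl addrAC subrr add0r.
- by rewrite memvZ.
exists (\sum_(i < N) nu (T i *: u i)) => k.
have [kN|Nk] := ltnP k N; last first.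
  rewrite TN ?leqW// scale0r norm_zero// sumr_ge0// => i _; exact: norm_ge0.
rewrite (bigD1 (Ordinal kN))//= lerDl sumr_ge0// => i _; exact: norm_ge0.
Qed.

End Splitting.

(** The splitting consists of the initial values of bounded solutions and a complement of them;
    Perron's sums give the rates on each. *)
Theorem admissible_exponential_dichotomy :
  admissible nu A -> exponential_dichotomy nu A.
Proof.
move=> adm; have [L1 L1P] := bounded_solutions_vspace.
have [c c0 cP] := proj_bounded_solutions L1P.
have [s s0 sP] := admissible_unique_bound L1P adm.
have sc0 : 0 < s + c by rewrite addr_gt0.
have w0 v : v != 0 -> forall n, 0 < nu (sol A v n).
  by move=> v0 n; apply: norm_gt0 => //; exact: sol_neq0.
have sol0 n : nu (sol A 0 n) = 0.
  by rewrite -(scale0r 0) solZ scale0r norm_zero.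
apply/exponential_dichotomyP.
exists L1, (L1^C)%VS, (1 + (s + c)), ((s + c) / (1 + (s + c))); split.
- by split; [exact: addv_complf | apply/directv_addP/capv_compl].
- exact: perron_constants.
- move=> v vL; have [->|v0] := eqVneq v 0.
    by move=> m h /=; rewrite !sol0 mulr0.
  apply: sum_inv_contracts => //; first exact: w0.
  by move=> n; exact: (perron_contracts L1P).
- move=> v vL; have [->|v0] := eqVneq v 0.
    by move=> m h /=; rewrite !sol0 mulr0.
  apply: sum_inv_expands => //; first exact: w0.
  (* [s] is weakened to [s + c] so that both subspaces share the same constants. *)
  move=> n N; rewrite (@le_trans _ _ s)// ?lerDl ?(ltW c0)//.
  exact: (@perron_expands L1).
Qed.

End Perron.

(** * Exponential dichotomy implies admissibility *)

Lemma expr_small (R : realType) (q e : R) : 0 < q < 1 -> 0 < e ->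
  exists h, q ^+ h <= e.
Proof.
move=> /andP[q0 q1] e0.
have q1' : `|q| < 1 by rewrite ger0_norm// ltW.
have [N _ NP] := @cvgr0_norm_le _ _ _ _ _ _ (cvg_expr q1') _ e0.
exists N; rewrite (le_trans (ler_norm _))//.
by have := NP N (leqnn N).
Qed.

(** The exponent is the distance between [n] and [k.+1], the time at which a forcing at [k] takes
    effect; this is the total weight of a Green function at time [n]. *)
Lemma two_sided_geometric_sum (R : realType) (q : R) n N : 0 < q < 1 ->
  \sum_(k < N) q ^+ (if (k < n)%N then n - k.+1 else k.+1 - n)%N
    <= 2 / (1 - q).
Proof.
move=> /andP[q0 q1]; have q1' : 0 < 1 - q by rewrite subr_gt0.
set G := (1 - q)^-1; have G0 : 0 < G by rewrite invr_gt0.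
have GE : G = 1 + q * G.
  by apply: (mulfI (lt0r_neq0 q1')); rewrite mulrDr mulrCA mulfV ?gt_eqF//; lra.
(* A sharper bound that survives induction. By truncated subtraction it reads [G * q ^+ (n - N)] up
   to [N = n], and [G + G - G * q ^+ (N - n)] afterwards. *)
have : \sum_(k < N) q ^+ (if (k < n)%N then n - k.+1 else k.+1 - n)%N
    <= G * q ^+ (n - N) + G - G * q ^+ (N - n).
  elim: N => [|N ih].
    by rewrite big_ord0 sub0n expr0 mulr1 addrK mulr_ge0 ?exprn_ge0 ?ltW.
  rewrite big_ord_recr/=; case: ltnP => Nn.
    have e1 : (N - n = 0)%N by apply/eqP; rewrite subn_eq0 ltnW.
    have e2 : (N.+1 - n = 0)%N by apply/eqP; rewrite subn_eq0.
    move: ih; rewrite e1 e2 expr0 mulr1 !addrK -(subnSK Nn) exprS.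
    have GEt t : G * t = t + q * G * t by rewrite {1}GE mulrDl mul1r.
    by rewrite (mulrCA G) mulrA => ih; rewrite [leRHS]GEt addrC lerD2l.
  have e1 : (n - N = 0)%N by apply/eqP; rewrite subn_eq0.
  have e2 : (n - N.+1 = 0)%N by apply/eqP; rewrite subn_eq0 leqW.
  move: ih; rewrite e1 e2 expr0 mulr1 subSn// exprS.
  have : 0 <= q ^+ (N - n) by rewrite exprn_ge0 ?ltW.
  set t := _ ^+ _; set S := \sum_(_ < _) _ => t0 ih.
  have -> : G * (q * t) = G * t - t by rewrite {2}GE; ring.
  nra.
move=> /le_trans; apply.
have h1 : q ^+ (n - N) <= 1 by rewrite exprn_ile1 ?ltW.
have h2 : 0 <= q ^+ (N - n) by rewrite exprn_ge0 ?ltW.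
nra.
Qed.

Section Green.

Variables (R : realType) (d : nat) (nu : 'cV[R]_d -> R).
Hypothesis nuP : is_norm nu.
Variable A : nat -> 'M[R]_d.

Lemma sol_growth (a : R) : 0 < a -> (forall n x, nu (A n *m x) <= a * nu x) ->
  forall x m h, nu (sol A x (m + h)%N) <= a ^+ h * nu (sol A x m).
Proof.
move=> a0 Aa x m; elim=> [|h ih]; first by rewrite addn0 expr0 mul1r.
by rewrite addnS /= (le_trans (Aa _ _))// exprS -mulrA ler_wpM2l// ltW.
Qed.

(* Over a time [h] with [K q^h <= 1/2] the [L1] part halves and the [L2] part
   doubles, so a sum much smaller than its [L1] part would have to grow faster
   than the system allows. *)
Lemma dichotomy_projection_bound (a : R) (L1 L2 : {vspace 'cV[R]_d}) K q :
  0 < a -> (forall n x, nu (A n *m x) <= a * nu x) ->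
  rate_constants K q ->
  (forall x, x \in L1 -> contracts K q (nu \o sol A x)) ->
  (forall x, x \in L2 -> expands K q (nu \o sol A x)) ->
  exists2 M, 0 < M & forall x1 x2 n, x1 \in L1 -> x2 \in L2 ->
    nu (sol A x1 n) <= M * nu (sol A (x1 + x2) n).
Proof.
move=> a0 Aa [K0 q01] h1 h2.
have [h hP] : exists h, q ^+ h <= 2^-1 / K.
  by apply: expr_small => //; rewrite divr_gt0.
have {}hP : K * q ^+ h <= 2^-1 by rewrite mulrC -ler_pdivlMr.
exists (a ^+ h + 2) => [|x1 x2 n x1L x2L]; first by rewrite ltr_wpDl// exprn_ge0// ltW.
have U1 := h1 x1 x1L n h; have U2 := h2 x2 x2L n h; rewrite /= in U1 U2.
have S := sol_growth a0 Aa (x1 + x2) n h.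
have {}U1 : nu (sol A x1 (n + h)%N) <= 2^-1 * nu (sol A x1 n).
  by rewrite (le_trans U1)// ler_wpM2r// norm_ge0.
have {}U2 : nu (sol A x2 n) <= 2^-1 * nu (sol A x2 (n + h)%N).
  by rewrite (le_trans U2)// ler_wpM2r// norm_ge0.
have T2 : nu (sol A x2 (n + h)%N) <=
    nu (sol A (x1 + x2) (n + h)%N) + nu (sol A x1 (n + h)%N).
  by rewrite (le_trans _ (norm_sub nuP _ _))// -solB addrAC subrr add0r.
have T1 : nu (sol A x1 n) <= nu (sol A (x1 + x2) n) + nu (sol A x2 n).
  by rewrite (le_trans _ (norm_sub nuP _ _))// -solB addrK.
have := norm_ge0 nuP (sol A x1 n).
by move: S U1 U2 T1 T2; rewrite mulrDl; lra.
Qed.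

(** Superposition of Green functions: split each forcing value at time k + 1 along the dichotomy,
    carry the [L1] part forwards and the negated [L2] part backwards, where both decay
    geometrically. *)
Theorem exponential_dichotomy_admissible (a : R) :
  (forall n, A n \in unitmx) ->
  0 < a -> (forall n x, nu (A n *m x) <= a * nu x) ->
  exponential_dichotomy nu A -> admissible nu A.
Proof.
move=> Au a0 Aa /exponential_dichotomyP[L1 [L2 [K [q [[L _] Kq h1 h2]]]]].
have [M M0 MP] := dichotomy_projection_bound a0 Aa Kq h1 h2.
have [K0 q01] := Kq; have /andP[q0 q1] := q01.
have C0 : 0 < K * (M + 1) by rewrite mulr_gt0// addr_gt0.
exists (K * (M + 1) * (2 / (1 - q))).
  by rewrite mulr_gt0// divr_gt0// subr_gt0.
move=> f n0 f1 fn0.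
have /choice[w wP] (k : nat) : exists w : 'cV[R]_d * 'cV[R]_d,
    [/\ w.1 \in L1, w.2 \in L2 & sol A (w.1 + w.2) k.+1 = f k].
  have [x xE] := sol_surj (f k) k.+1 Au.
  have : x \in (L1 + L2)%VS by rewrite L memvf.
  by move=> /memv_addP[x1 x1L [x2 x2L xx]]; exists (x1, x2); rewrite /= -xx.
(* The jump of [g k] between times [k] and [k.+1], from minus the [L2] part to the [L1] part, is
   exactly [f k]. *)
pose g k n := if (k < n)%N then sol A (w k).1 n else - sol A (w k).2 n.
have gS k n : g k n.+1 = A n *m g k n + (if k == n then f n else 0).
  rewrite /g ltnS; have [kn|kn|<-] := ltngtP k n.
  - by rewrite addr0.
  - by rewrite addr0 mulmxN.
  - by have [_ _ <-] := wP k; rewrite mulmxN solD /= addrC addrK.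
exists (fun n => \sum_(k < n0) g k n) => n.
  under eq_bigr do rewrite gS.
  rewrite big_split/= mulmx_sumr; congr (_ + _).
  have [nn0|nn0] := ltnP n n0.
    rewrite (bigD1 (Ordinal nn0))//= eqxx big1 ?addr0// => i.
    by rewrite -val_eqE/= => /negPf->.
  by rewrite fn0// big1// => i _; case: eqP.
rewrite (le_trans (norm_sum nuP _ _ _))//.
apply: le_trans (ler_wpM2l (ltW C0) (two_sided_geometric_sum n n0 q01)).
rewrite mulr_sumr ler_sum// => -[k /= _] _; rewrite /g.
have [w1 w2 wE] := wP k.
have b1 : nu (sol A (w k).1 k.+1) <= M.
  have := MP _ _ k.+1 w1 w2; rewrite wE => /le_trans; apply.
  by rewrite ler_piMr// ltW.
have b2 : nu (sol A (w k).2 k.+1) <= M + 1.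
  have -> : sol A (w k).2 k.+1 = f k - sol A (w k).1 k.+1.
    by rewrite -wE solD addrAC subrr add0r.
  by rewrite (le_trans (norm_sub nuP _ _))// addrC lerD.
case: ltnP => kn.
  have := h1 _ w1 k.+1 (n - k.+1)%N; rewrite /comp subnKC// => /le_trans; apply.
  rewrite [leRHS]mulrAC ler_wpM2l// ?mulr_ge0 ?exprn_ge0 ?ltW//.
  by rewrite (le_lt_trans b1)// ltrDl.
rewrite norm_opp//; have := h2 _ w2 n (k.+1 - n)%N; rewrite /comp subnKC ?leqW//.
by move=> /le_trans; apply; rewrite [leRHS]mulrAC ler_wpM2l// mulr_ge0 ?exprn_ge0 ?ltW.
Qed.

End Green.

(** * Single solutions and scalar equations *)

Lemma eventually_lower_bound (R : realType) (w v : nat -> R) (c0 : R) n0 :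
  (forall n, 0 < w n) -> (forall n, 0 < v n) -> 0 < c0 ->
  (forall n, (n0 <= n)%N -> c0 * v n <= w n) ->
  exists2 c, 0 < c & forall n, c * v n <= w n.
Proof.
move=> w0 v0; elim: n0 c0 => [|n0 ih] c0 c00 h; first by exists c0 => // n; exact: h.
apply: (ih (Num.min c0 (w n0 / v n0))); first by rewrite lt_min c00 divr_gt0.
move=> n; rewrite leq_eqVlt => /predU1P[<-|nn0].
  by rewrite -ler_pdivlMr// ge_min lexx orbT.
by rewrite (le_trans _ (h n nn0))// ler_wpM2r ?(ltW (v0 n))// ge_min lexx.
Qed.

Section BohlDichotomy.

Variables (R : realType) (d : nat) (nu : 'cV[R]_d -> R).
Hypothesis nuP : is_norm nu.
Variable A : nat -> 'M[R]_d.
Hypothesis Au : forall n, A n \in unitmx.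

(** If the component [x2] in [L2] is nonzero, it dominates: [x1] decays while [x2] grows, so the
    norms of the solutions through [x] and [x2] are comparable and [x] inherits the expansion. *)
Lemma bohl_dichotomy_solution x : bohl_dichotomy nu A -> x != 0 ->
  contracting (nu \o sol A x) \/ expanding (nu \o sol A x).
Proof.
move=> /bohl_dichotomyW[L1 [L2 [L h1 h2]]] x0.
have : x \in (L1 + L2)%VS by rewrite L memvf.
move=> /memv_addP[x1 x1L [x2 x2L xE]].
have [x20|x20] := eqVneq x2 0; first by left; rewrite xE x20 addr0; exact: h1.
right; have [K1 [q1 [[K10 q1P] c1]]] := h1 x1 x1L.
have [K2 [q2 [[K20 q2P] c2]]] := h2 x2 x2L.
have [/andP[q10 q11] /andP[q20 q21]] := (q1P, q2P).
pose w n := nu (sol A x n); pose w1 n := nu (sol A x1 n).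
pose w2 n := nu (sol A x2 n).
have w0 n : 0 < w n by apply: norm_gt0 => //; exact: sol_neq0.
have w20 n : 0 < w2 n by apply: norm_gt0 => //; exact: sol_neq0.
have w10 n : 0 <= w1 n by exact: norm_ge0.
pose D := K1 * w1 0 * K2 / w2 0.
have D0 : 0 <= D by rewrite divr_ge0 ?(ltW (w20 _))// !mulr_ge0// ltW.
have w12 n : w1 n <= D * q1 ^+ n * w2 n.
  have b1 : w1 n <= K1 * q1 ^+ n * w1 0 := c1 0%N n.
  have b2 : w2 0 <= K2 * q2 ^+ n * w2 n := c2 0%N n.
  rewrite (le_trans b1)//.
  have {}b2 : w2 0 <= K2 * w2 n.
    rewrite (le_trans b2)// -mulrA ler_wpM2l ?(ltW K20)//.
    by rewrite ler_piMl ?exprn_ile1 ?ltW.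
  have {}b2 : 1 <= K2 / w2 0 * w2 n by rewrite mulrAC ler_pdivlMr// mul1r.
  have -> : D * q1 ^+ n * w2 n = K1 * q1 ^+ n * w1 0 * (K2 / w2 0 * w2 n).
    by rewrite /D; ring.
  by rewrite ler_peMr// !mulr_ge0 ?exprn_ge0 ?(ltW K10) ?(ltW q10).
(* From [n0] on the [x1] part is at most half of the [x2] part; the finitely many earlier times only
   lower the constant, since [w] is positive. *)
have [n0 n0P] : exists n0, q1 ^+ n0 <= 2^-1 / (1 + D).
  by apply: expr_small => //; rewrite divr_gt0// ltr_wpDr.
have Dq n : (n0 <= n)%N -> D * q1 ^+ n <= 2^-1.
  move=> nn0; apply: le_trans (_ : (1 + D) * q1 ^+ n0 <= _).
    by rewrite ler_pM ?exprn_ge0 ?ler_wpDl ?(ltW q10)// ler_wiXn2l ?ltW.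
  by rewrite mulrC -ler_pdivlMr// ltr_wpDr.
have [c c0 cP] : exists2 c, 0 < c & forall n, c * w2 n <= w n.
  apply: (@eventually_lower_bound _ _ _ 2^-1 n0) => // n /Dq Dn.
  have : w2 n <= w n + w1 n.
    by rewrite (le_trans _ (norm_sub nuP _ _))// -solB xE addrAC subrr add0r.
  have : w1 n <= 2^-1 * w2 n.
    by rewrite (le_trans (w12 n))// ler_wpM2r// ltW.
  lra.
have ww2 n : w n <= (1 + D) * w2 n.
  rewrite /w xE solD (le_trans (norm_add nuP _ _))// addrC mulrDl mul1r lerD2l.
  rewrite (le_trans (w12 n))// -mulrA ler_wpM2l// ler_piMl ?(ltW (w20 n))//.
  by rewrite exprn_ile1 ?ltW.
exists ((1 + D) * K2 / c), q2; split.
  by split=> //; rewrite divr_gt0// mulr_gt0// ltr_wpDr.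
move=> m h; rewrite /comp -/(w m) -/(w (m + h)%N) (le_trans (ww2 m))//.
have -> : (1 + D) * K2 / c * q2 ^+ h * w (m + h)%N =
  (1 + D) * (K2 * q2 ^+ h * (w (m + h)%N / c)) by ring.
rewrite ler_wpM2l ?ler_wpDr// (le_trans (c2 m h))// ler_wpM2l//.
  by rewrite mulr_ge0 ?exprn_ge0 ?ltW.
by rewrite /= ler_pdivlMr// mulrC cP.
Qed.

End BohlDichotomy.

(** * Scalar equations with bounded forcing *)

Section ScalarEquations.

Variables (R : realType) (a : nat -> R).
Hypothesis a0 : forall n, a n != 0.

Definition scalar_sol n := \prod_(k < n) a k.

Let phi := scalar_sol.

Lemma scalar_solS n : phi n.+1 = a n * phi n.
Proof. by rewrite /phi /scalar_sol big_ord_recr mulrC. Qed.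

Lemma scalar_sol_neq0 n : phi n != 0.
Proof. by apply/prodf_neq0 => i _. Qed.

Lemma scalar_sol_gt0 n : 0 < `|phi n|.
Proof. by rewrite normr_gt0 scalar_sol_neq0. Qed.

Definition scalar_dichotomy :=
  contracting (fun n => `|phi n|) \/ expanding (fun n => `|phi n|).

(** Variation of constants from the initial value 0: [f k] reaches time n with the factor
    [phi n / phi k.+1], which decays in n - (k + 1). *)
Lemma contracting_forced_sol : contracting (fun n => `|phi n|) ->
  exists2 r, 0 < r & forall f F, (forall n, `|f n| <= F) ->
  exists2 x : nat -> R, (forall n, x n.+1 = a n * x n + f n)
                      & forall n, `|x n| <= r * F.
Proof.
move=> [K [q [[K0 q01] h]]]; have /andP[q0 q1] := q01.
have r0 : 0 < K * (2 / (1 - q)) by rewrite mulr_gt0// divr_gt0// subr_gt0.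
exists (K * (2 / (1 - q))) => // f F fF.
have F0 : 0 <= F by rewrite (le_trans _ (fF 0%N)).
exists (fun n => phi n * \sum_(k < n) f k / phi k.+1) => n.
  rewrite big_ord_recr/= mulrDr [phi n.+1 * (_ / _)]mulrC.
  by rewrite divfK ?scalar_sol_neq0// scalar_solS mulrA.
rewrite mulr_sumr (le_trans (ler_norm_sum _ _ _))//.
rewrite mulrAC.
apply: le_trans (ler_wpM2l (mulr_ge0 (ltW K0) F0) (two_sided_geometric_sum n n q01)).
rewrite mulr_sumr ler_sum// => -[k /= kn] _; rewrite kn.
have := h k.+1 (n - k.+1)%N; rewrite subnKC// => hk.
rewrite mulrCA !normrM normfV (mulrAC K) [leRHS]mulrC.
by rewrite ler_pM ?mulr_ge0 ?invr_ge0// ler_pdivrMr ?scalar_sol_gt0.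
Qed.

(** The bounded solution is minus the sum of [phi n / phi k.+1 * f k] over k >= n. It is written as
    a partial sum minus the full sum, which converges because 1/[phi k.+1] decays geometrically. *)
Lemma expanding_forced_sol : expanding (fun n => `|phi n|) ->
  exists2 r, 0 < r & forall f F, (forall n, `|f n| <= F) ->
  exists2 x : nat -> R, (forall n, x n.+1 = a n * x n + f n)
                      & forall n, `|x n| <= r * F.
Proof.
move=> [K [q [[K0 q01] h]]]; have /andP[q0 q1] := q01.
have r0 : 0 < K * (2 / (1 - q)) by rewrite mulr_gt0// divr_gt0// subr_gt0.
exists (K * (2 / (1 - q))) => // f F fF.
have F0 : 0 <= F by rewrite (le_trans _ (fF 0%N)).
have phi_div n k : (n <= k)%N -> `|phi n| / `|phi k.+1| <= K * q ^+ (k.+1 - n).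
  move=> nk; rewrite ler_pdivrMr ?scalar_sol_gt0//.
  by have := h n (k.+1 - n)%N; rewrite subnKC// leqW.
pose u k := f k / phi k.+1.
have su : cvgn (series u).
  apply: normed_cvg; apply: (@series_le_cvg _ _ (geometric (F * K * q) q)).
  - by move=> n; rewrite normr_ge0.
  - by move=> n; rewrite /geometric /= !mulr_ge0 ?exprn_ge0 ?(ltW K0) ?(ltW q0).
  - move=> k; rewrite /u /geometric /= normrM normfV -!mulrA ler_pM ?invr_ge0//.
    have := phi_div 0%N k (leq0n k); rewrite subn0 exprS.
    by rewrite /phi /scalar_sol big_ord0 normr1 mul1r.
  - by apply: is_cvg_geometric_series; rewrite ger0_norm ?ltW.
(* The bounded solution is the one starting at [- s]. *)
set s := limn (series u) in su.
exists (fun n => phi n * (series u n - s)) => n.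
  rewrite seriesSr scalar_solS -mulrA addrAC mulrDr mulrDr; congr (_ + _).
  by rewrite mulrA -scalar_solS /u mulrC divfK// scalar_sol_neq0.
(* The infinite tail is bounded through its finite truncations, uniformly in [N]. *)
have lim : (fun N => `|phi n * (series u n - series u N)|) @ \oo -->
    `|phi n * (series u n - s)|.
  by apply: cvg_norm; apply: cvgMl_tmp; apply: cvgB => //; exact: cvg_cst.
apply: (cvgr_to_le lim); exists n => // N /= nN.
have -> : phi n * (series u n - series u N) = - \sum_(n <= k < N) (phi n * u k).
  by rewrite -mulr_sumr -sub_series_geq// -mulrN opprB.
rewrite normrN (le_trans (ler_norm_sum _ _ _))//.
rewrite mulrAC.
apply: le_trans (ler_wpM2l (mulr_ge0 (ltW K0) F0) (two_sided_geometric_sum n N q01)).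
rewrite mulr_sumr -(big_mkord xpredT
  (fun k => K * F * q ^+ (if (k < n)%N then n - k.+1 else k.+1 - n)%N)).
rewrite [leRHS](@big_cat_nat _ _ _ n)//= ler_wpDl//.
  by rewrite sumr_ge0// => k _; rewrite !mulr_ge0 ?exprn_ge0 ?(ltW K0) ?(ltW q0).
rewrite big_nat_cond [leRHS]big_nat_cond ler_sum// => k /andP[/andP[nk _] _].
rewrite ltnNge nk/= /u mulrCA !normrM normfV (mulrAC K) [leRHS]mulrC.
by rewrite ler_pM ?mulr_ge0 ?invr_ge0// phi_div.
Qed.

Lemma scalar_dichotomy_forced_sol : scalar_dichotomy ->
  exists2 r, 0 < r & forall f F, (forall n, `|f n| <= F) ->
  exists2 x : nat -> R, (forall n, x n.+1 = a n * x n + f n)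
                      & forall n, `|x n| <= r * F.
Proof.
by move=> [/contracting_forced_sol|/expanding_forced_sol].
Qed.

End ScalarEquations.

(** * Upper triangular systems *)

Section TriangularSystems.

Variables (R : realType) (d : nat) (nu : 'cV[R]_d -> R).
Hypothesis nuP : is_norm nu.
Implicit Type A : nat -> 'M[R]_d.

Lemma upper_triangular_unitP A n : upper_triangular A ->
  reflect (forall i, A n i i != 0) (A n \in unitmx).
Proof.
move=> AT; rewrite unitmxE -det_tr det_trig.
  rewrite unitfE; apply: (iffP idP) => [/prodf_neq0 h i|h].
    by have := h i isT; rewrite mxE.
  by apply/prodf_neq0 => i _; rewrite mxE.
by apply/is_trig_mxP => i j ij; rewrite mxE AT.
Qed.

Definition solves_from k A (f x : nat -> 'cV[R]_d) := forall (i : 'I_d),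
  (k <= i)%N -> forall n, x n.+1 i 0 = (A n *m x n) i 0 + f n i 0.

(** Rows are solved from the last one upwards. Keeping the coordinates above the solved block at 0
    makes each new row a scalar equation, forced by [f] and the coordinates already found. *)
Lemma triangular_back_substitution A (M e : R) :
  upper_triangular A -> (forall n i j, `|A n i j| <= M) ->
  (forall n i, A n i i != 0) ->
  (forall i, scalar_dichotomy (fun n => A n i i)) ->
  forall k, (k <= d)%N -> exists r, forall f : nat -> 'cV[R]_d,
    (forall n i, `|f n i 0| <= e) -> exists x : nat -> 'cV[R]_d,
    [/\ solves_from (d - k) A f x, forall n i, `|x n i 0| <= r
      & forall (i : 'I_d), (i < d - k)%N -> forall n, x n i 0 = 0].
Proof.
move=> AT AM A0 Ad; elim=> [_|k ih kd].
  exists 0 => f fe; exists (fun=> 0); split=> [i|n i|i _ n].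
  - by rewrite subn0 leqNgt ltn_ord.
  - by rewrite mxE normr0.
  - by rewrite mxE.
have [r rP] := ih (ltnW kd).
have i0P : (d - k.+1 < d)%N by rewrite -subn_gt0 subKn.
pose i0 := Ordinal i0P; have i0S : (d - k)%N = i0.+1 by rewrite /= subnSK.
have [s s0 sP] := scalar_dichotomy_forced_sol (fun n => A0 n i0) (Ad i0).
(* Bounds the new forcing: [e] for [f], and [M * r] for each of the [d] terms of the row applied to
   [x]. *)
pose F := e + d%:R * (M * r).
exists (r + s * F) => f fe; have [x [xs xr x0]] := rP f fe.
have gF n : `|f n i0 0 + (A n *m x n) i0 0| <= F.
  rewrite (le_trans (ler_normD _ _))// lerD// mxE.
  rewrite (le_trans (ler_norm_sum _ _ _))// mulr_natl -[X in _ *+ X]card_ord.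
  by rewrite -sumr_const ler_sum// => j _; rewrite normrM ler_pM.
have [y ys yr] := sP _ F gF.
exists (fun n => x n + y n *: delta_mx i0 0).
have ei (i : 'I_d) n : (x n + y n *: delta_mx i0 0) i 0
    = x n i 0 + y n * (i == i0)%:R by rewrite !mxE eqxx andbT.
have Axy n i : (A n *m (x n + y n *: delta_mx i0 0)) i 0
    = (A n *m x n) i 0 + y n * A n i i0.
  by rewrite mulmxDr -scalemxAr -colE !mxE.
split=> [i|n i|i].
- rewrite leq_eqVlt => /predU1P[iE|ii0] n.
    have -> : i = i0 by apply: val_inj.
    rewrite ei Axy eqxx mulr1 x0 ?i0S// add0r ys.
    by ring.
  rewrite ei Axy xs ?i0S// -val_eqE/= gtn_eqF// mulr0 addr0.
  (* The new coordinate [i0] does not disturb the rows already solved, by triangularity. *)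
  by rewrite (AT n i i0)// mulr0 addr0.
- rewrite ei (le_trans (ler_normD _ _))// lerD// normrM.
  rewrite (le_trans _ (yr n))// ler_piMr//.
  by case: eqP; rewrite ?normr1 ?normr0.
- move=> ii0 n; rewrite ei x0 ?i0S ?leqW// -val_eqE/= ltn_eqF//.
  by rewrite mulr0 addr0.
Qed.

Lemma triangular_admissible A (M : R) :
  upper_triangular A -> (forall n i j, `|A n i j| <= M) ->
  (forall n i, A n i i != 0) ->
  (forall i, scalar_dichotomy (fun n => A n i i)) -> admissible nu A.
Proof.
move=> AT AM A0 Ad; have [c c0 cP] := norm_le_entries nuP.
have [e e0 eP] := entry_le_norm nuP.
have [r rP] := triangular_back_substitution e AT AM A0 Ad (leqnn d).
exists (c * (`|r| + 1)); first by rewrite mulr_gt0// ltr_wpDl.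
move=> f n0 f1 _; have [n i|x [xs xr _]] := rP f.
  by rewrite (le_trans (eP _ _))// ler_piMr// ltW.
exists x => [n|n].
  by apply/matrixP => i j; rewrite ord1 xs ?subnn// [in RHS]mxE.
apply: cP => [|i]; first by rewrite addr_ge0.
by rewrite (le_trans (xr n i))// ler_wpDr// ler_norm.
Qed.

(* Rows below [i0] are made trivially contracting, so that the [i0]-th
   coordinate axis becomes invariant while the lower-right block is kept. *)
Definition lower_block (i0 : 'I_d) A n : 'M[R]_d :=
  \matrix_(i, j) if (i0 <= i)%N then A n i j else (i == j)%:R * 2^-1.

Lemma lower_block_triangular i0 A :
  upper_triangular A -> upper_triangular (lower_block i0 A).
Proof.
move=> AT n i j ji; rewrite mxE AT//; case: ifP => // _.
by rewrite -val_eqE gtn_eqF// mul0r.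
Qed.

Lemma lower_block_unit i0 A n : upper_triangular A -> A n \in unitmx ->
  lower_block i0 A n \in unitmx.
Proof.
move=> AT /(upper_triangular_unitP _ AT) An.
apply/(upper_triangular_unitP _ (lower_block_triangular i0 AT)) => i.
by rewrite mxE; case: ifP => // _; rewrite eqxx mul1r invr_neq0.
Qed.

(** In column [i0], the entries with larger row index vanish by triangularity and those with smaller
    row index by the replacement. *)
Lemma lower_block_axis i0 A n : upper_triangular A ->
  lower_block i0 A n *m delta_mx i0 0 = A n i0 i0 *: delta_mx i0 0 :> 'cV[R]_d.
Proof.
move=> AT; rewrite -colE; apply/matrixP => i j; rewrite !mxE ord1 eqxx andbT.
have [->|ii0] := eqVneq i i0; first by rewrite leqnn mulr1.
rewrite mul0r mulr0; case: ifP => // i0i; apply: AT.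
by rewrite ltn_neqAle i0i andbT eq_sym.
Qed.

Lemma half_forced_sol : exists2 r : R, 0 < r & forall f F, (forall n, `|f n| <= F) ->
  exists2 x : nat -> R, (forall n, x n.+1 = 2^-1 * x n + f n)
                      & forall n, `|x n| <= r * F.
Proof.
apply: (@scalar_dichotomy_forced_sol _ (fun=> 2^-1)) => [n|]; first by rewrite invr_neq0.
left; exists 1, 2^-1; split; first by split=> //; lra.
move=> m h; rewrite /scalar_sol !prodr_const !card_ord mul1r exprD normrM mulrC.
by rewrite ler_wpM2r// ger0_norm// exprn_ge0// invr_ge0.
Qed.

(** By triangularity the rows from [i0] on involve only coordinates from [i0] on, so there a
    solution for [A] also solves the block system. The remaining rows are decoupled equations with
    coefficient 1/2. *)
Lemma lower_block_admissible i0 A : upper_triangular A ->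
  admissible nu A -> admissible nu (lower_block i0 A).
Proof.
move=> AT [r r0 rP]; have [c c0 cP] := norm_le_entries nuP.
have [e e0 eP] := entry_le_norm nuP; have [s s0 sP] := half_forced_sol.
have ce0 : 0 < c * e by rewrite mulr_gt0.
exists (c * (c * e * (e * r) + s * e)).
  by rewrite mulr_gt0// addr_gt0 ?mulr_gt0.
move=> f n0 f1 fn0.
have fe n i : `|f n i 0| <= e.
  by rewrite (le_trans (eP _ _))// ler_piMr// ltW.
(* Dropping coordinates may increase [nu] up to [c * e]; the scaling restores size at most 1 and is
   undone in [y]. *)
pose g n : 'cV[R]_d := (c * e)^-1 *:
  \col_i (if (i0 <= i)%N then f n i 0 else 0).
have [n|n nn0|x xs xr] := rP g n0.
- rewrite /g norm_scale// ger0_norm ?invr_ge0 ?(ltW ce0)//.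
  rewrite ler_pdivrMl// mulr1; apply: cP => [|i]; first exact: ltW.
  by rewrite mxE; case: ifP => // _; rewrite normr0 ltW.
- rewrite /g; apply/matrixP => i j; rewrite !mxE fn0// mxE.
  by case: ifP => _; rewrite mulr0.
have /choice[z zP] (i : 'I_d) : exists z : nat -> R,
    (forall n, z n.+1 = 2^-1 * z n + f n i 0) /\ forall n, `|z n| <= s * e.
  by have [z z1 z2] := sP (fun n => f n i 0) e (fun n => fe n i); exists z.
pose y n : 'cV[R]_d := \col_i (if (i0 <= i)%N then c * e * x n i 0 else z i n).
exists y => n.
  apply/matrixP => i j; rewrite ord1 {j} [RHS]mxE [LHS]mxE [X in _ = X + _]mxE.
  case: ifPn => i0i.
    rewrite xs [in LHS]mxE mulrDr; congr (_ + _); last first.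
      by rewrite !mxE i0i mulrA mulfV ?gt_eqF// mul1r.
    rewrite mxE mulr_sumr; apply: eq_bigr => j _; rewrite !mxE i0i.
    case: ifPn => i0j; first by rewrite mulrCA.
    by rewrite AT ?mul0r ?mulr0// (leq_trans _ i0i)// ltnNge.
  have [zS _] := zP i; rewrite zS; congr (_ + _).
  rewrite (bigD1 i)//= big1 => [|j ji]; rewrite !mxE (negPf i0i).
    by rewrite eqxx mul1r addr0.
  by rewrite eq_sym (negPf ji) !mul0r.
apply: cP => [|i]; first by rewrite addr_ge0// ?mulr_ge0 ?ltW ?mulr_gt0.
rewrite mxE; case: ifP => _; last first.
  by rewrite (le_trans ((zP i).2 n))// ler_wpDl// !mulr_ge0// ltW.
rewrite ler_wpDr ?mulr_ge0 ?(ltW s0) ?(ltW e0)// normrM ger0_norm ?(ltW ce0)//.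
rewrite ler_wpM2l ?(ltW ce0)// (le_trans (eP _ _))// ler_wpM2l ?(ltW e0)//.
Qed.

Lemma sol_eigenvector A (a : nat -> R) v :
  (forall n, A n *m v = a n *: v) -> forall n, sol A v n = scalar_sol a n *: v.
Proof.
move=> Av; elim=> [|n ih] /=; first by rewrite /scalar_sol big_ord0 scale1r.
by rewrite ih -scalemxAr Av scalerA mulrC scalar_solS.
Qed.

Lemma eigenvector_dichotomy A (a : nat -> R) v : v != 0 ->
  (forall n, A n *m v = a n *: v) ->
  contracting (nu \o sol A v) \/ expanding (nu \o sol A v) -> scalar_dichotomy a.
Proof.
move=> v0 Av; have nv0 := norm_gt0 nuP v0.
have -> : nu \o sol A v = fun n => `|scalar_sol a n| * nu v.
  by apply/funext => n /=; rewrite (sol_eigenvector Av) norm_scale.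
by case=> [/contracting_scale|/expanding_scale] h; [left|right]; exact: h.
Qed.

Lemma delta_col_neq0 (i : 'I_d) : (delta_mx i 0 : 'cV[R]_d) != 0.
Proof.
by apply/eqP => /matrixP/(_ i 0)/eqP; rewrite !mxE !eqxx/= oner_eq0.
Qed.

(** The detour through admissibility turns the dichotomy of [A] into one of [lower_block i A], where
    the axis of [i] carries a solution whose scalar factor is the [i]-th diagonal equation. *)
Lemma exponential_dichotomy_diagonal A (M : R) :
  (forall n, A n \in unitmx) -> upper_triangular A ->
  0 <= M -> (forall n i j, `|A n i j| <= M) -> exponential_dichotomy nu A ->
  forall i, scalar_dichotomy (fun n => A n i i).
Proof.
move=> Au AT M0 AM Aed i; have [a a0 aP] := norm_mulmx_le nuP M0.
have adm : admissible nu A.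
  by apply: (exponential_dichotomy_admissible nuP Au a0) => // n; exact: aP.
have Bu n : lower_block i A n \in unitmx by apply: lower_block_unit.
apply: (@eigenvector_dichotomy (lower_block i A) _ (delta_mx i 0)).
- exact: delta_col_neq0.
- by move=> n; exact: lower_block_axis.
apply: bohl_dichotomy_solution => //; last exact: delta_col_neq0.
apply: exponential_bohl_dichotomy; apply: admissible_exponential_dichotomy => //.
exact: lower_block_admissible.
Qed.

Lemma diagonal_exponential_dichotomy A (M : R) :
  (forall n, A n \in unitmx) -> upper_triangular A ->
  (forall n i j, `|A n i j| <= M) ->
  (forall i, scalar_dichotomy (fun n => A n i i)) -> exponential_dichotomy nu A.
Proof.
move=> Au AT AM Ad; apply: admissible_exponential_dichotomy => //.
apply: (triangular_admissible AT AM) => // n.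
exact/upper_triangular_unitP.
Qed.

End TriangularSystems.

(** * Bohl exponents *)

Section EventualRates.

Variables (R : realType) (v : nat -> R).
Hypothesis v0 : forall n, 0 < v n.

(** Any [p] strictly between [q] and 1 absorbs [K] for large [h]; the midpoint is taken. This trades
    the constant of a dichotomy for the threshold [N] of a Bohl exponent. *)
Lemma rate_absorb (K q : R) : rate_constants K q ->
  exists N p, 0 < p < 1 /\ forall h, (N < h)%N -> K * q ^+ h <= p ^+ h.
Proof.
move=> [K0 /andP[q0 q1]]; pose p := (1 + q) / 2.
have p0 : 0 < p by rewrite /p; lra.
have qp : q < p by rewrite /p; lra.
have [N NP] : exists N, (q / p) ^+ N <= K^-1.
  by apply: expr_small; rewrite ?invr_gt0// divr_gt0//= ltr_pdivrMr// mul1r.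
exists N, p; split; first by rewrite p0 /p /=; lra.
move=> h Nh; rewrite -ler_pdivlMl// -ler_pdivrMr ?exprn_gt0// -expr_div_n.
rewrite (le_trans _ NP)// ler_wiXn2l ?(ltnW Nh)//; first by rewrite divr_ge0 ?ltW.
by rewrite ler_pdivrMr// mul1r ltW.
Qed.

Lemma contracting_eventually : contracting v -> exists N q, 0 < q < 1 /\
  forall m h, (N < h)%N -> v (m + h)%N <= q ^+ h * v m.
Proof.
move=> [K [q [Kq vP]]]; have [N [p [p01 NP]]] := rate_absorb Kq.
exists N, p; split=> // m h Nh; rewrite (le_trans (vP m h))// ler_wpM2r ?NP//.
exact: ltW.
Qed.

Lemma expanding_eventually : expanding v -> exists N q, 0 < q < 1 /\
  forall m h, (N < h)%N -> v m <= q ^+ h * v (m + h)%N.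
Proof.
move=> [K [q [Kq vP]]]; have [N [p [p01 NP]]] := rate_absorb Kq.
exists N, p; split=> // m h Nh; rewrite (le_trans (vP m h))// ler_wpM2r ?NP//.
exact: ltW.
Qed.

Variable a : R.
Hypothesis va : forall m h, v (m + h)%N <= a ^+ h * v m.
Hypothesis a1 : 1 <= a.

(** For [h] at most [N] the growth bound [a] takes over, at the cost of the factor
    [(a / q) ^+ N]. *)
Lemma eventually_contracting N q : 0 < q < 1 ->
  (forall m h, (N < h)%N -> v (m + h)%N <= q ^+ h * v m) -> contracting v.
Proof.
move=> q01 vP; have /andP[q0 q1] := q01.
have aN : 1 <= (a / q) ^+ N.
  by rewrite exprn_ege1// ler_pdivlMr// mul1r (le_trans (ltW q1)).
exists ((a / q) ^+ N), q; split; first by split=> //; rewrite (lt_le_trans _ aN).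
move=> m h; have [hN|Nh] := leqP h N; last first.
  rewrite (le_trans (vP m h Nh))// -mulrA ler_peMl// mulr_ge0 ?exprn_ge0 ?ltW//.
rewrite (le_trans (va m h))// ler_wpM2r ?(ltW (v0 _))// -ler_pdivrMr ?exprn_gt0//.
rewrite -expr_div_n ler_weXn2l// ler_pdivlMr// mul1r.
exact: le_trans (ltW q1) a1.
Qed.

(** The growth bound works forwards only, so the estimate is applied over [h + N.+1] steps and the
    surplus [N.+1] steps are paid for by [a ^+ N.+1]. *)
Lemma eventually_expanding N q : 0 < q < 1 ->
  (forall m h, (N < h)%N -> v m <= q ^+ h * v (m + h)%N) -> expanding v.
Proof.
move=> q01 vP; have /andP[q0 q1] := q01.
have aN : 1 <= a ^+ N.+1 by rewrite exprn_ege1.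
exists (a ^+ N.+1), q; split; first by split=> //; rewrite (lt_le_trans _ aN).
move=> m h; have Nh : (N < h + N.+1)%N by rewrite addnS ltnS leq_addl.
rewrite (le_trans (vP m _ Nh))// [a ^+ _ * _]mulrC -mulrA.
rewrite ler_pM ?exprn_ge0 ?(ltW q0) ?(ltW (v0 _)) ?addnA//.
by rewrite ler_wiXn2l ?leq_addr ?ltW.
Qed.

End EventualRates.

Section BohlExponents.

Variables (R : realType) (d : nat) (nu : 'cV[R]_d -> R).
Hypothesis nuP : is_norm nu.
Variable A : nat -> 'M[R]_d.
Hypothesis Au : forall n, A n \in unitmx.
Variable x : 'cV[R]_d.
Hypothesis x0 : x != 0.

Let w n := nu (sol A x n).

Lemma norm_sol_gt0 n : 0 < w n.
Proof. by apply: norm_gt0 => //; exact: sol_neq0. Qed.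

Lemma growth_rate_le m h b : (0 < h)%N ->
  (growth_rate nu A x (m + h) m <= b) = (w (m + h)%N <= expR b ^+ h * w m).
Proof.
move=> h0; have wp := norm_sol_gt0.
rewrite /growth_rate -/(w _) -/(w _) addKn ler_pdivrMl ?ltr0n//.
rewrite -{1}[h%:R * b]expRK expRM_natl ler_ln ?posrE ?divr_gt0 ?exprn_gt0 ?expR_gt0//.
by rewrite ler_pdivrMr.
Qed.

Lemma growth_rate_ge m h b : (0 < h)%N ->
  (b <= growth_rate nu A x (m + h) m) = (expR b ^+ h * w m <= w (m + h)%N).
Proof.
move=> h0; have wp := norm_sol_gt0.
rewrite /growth_rate -/(w _) -/(w _) addKn ler_pdivlMl ?ltr0n//.
rewrite -{1}[h%:R * b]expRK expRM_natl ler_ln ?posrE ?divr_gt0 ?exprn_gt0 ?expR_gt0//.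
by rewrite ler_pdivlMr.
Qed.

Variable g : R.

Lemma shifted_norm n : (nu \o sol (shifted A g) x) n = expR (- g) ^+ n * w n.
Proof.
by rewrite /= sol_shifted norm_scale// ger0_norm// exprn_ge0// expR_ge0.
Qed.

Lemma shifted_le q m h : 0 < q ->
  ((nu \o sol (shifted A g) x) (m + h)%N <= q ^+ h * (nu \o sol (shifted A g) x) m)
  = (w (m + h)%N <= expR (g + ln q) ^+ h * w m).
Proof.
move=> q0; rewrite !shifted_norm exprD mulrCA -!mulrA ler_pM2l ?exprn_gt0 ?expR_gt0//.
rewrite expRD lnK// exprMn expRN exprVn ler_pdivrMl ?exprn_gt0 ?expR_gt0//.
by rewrite mulrA.
Qed.

Lemma shifted_ge q m h : 0 < q ->
  ((nu \o sol (shifted A g) x) m <= q ^+ h * (nu \o sol (shifted A g) x) (m + h)%N)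
  = (expR (g - ln q) ^+ h * w m <= w (m + h)%N).
Proof.
move=> q0; rewrite !shifted_norm.
have -> : q ^+ h * (expR (- g) ^+ (m + h) * w (m + h)%N) =
    expR (- g) ^+ m * (q ^+ h * (expR (- g) ^+ h * w (m + h)%N)).
  by rewrite exprD; ring.
rewrite ler_pM2l ?exprn_gt0 ?expR_gt0// expRD [expR (- ln q)]expRN lnK//.
rewrite exprMn expRN !exprVn -[expR g ^+ h * _ * _]mulrA.
by rewrite -ler_pdivlMl ?exprn_gt0 ?expR_gt0// ler_pdivrMl ?exprn_gt0.
Qed.

Lemma shifted_gt0 n : 0 < (nu \o sol (shifted A g) x) n.
Proof. by rewrite shifted_norm mulr_gt0 ?exprn_gt0 ?expR_gt0// norm_sol_gt0. Qed.

(** All growth rates over gaps beyond [N] are at most [g + ln q]; the gap [ln q < 0] keeps the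
    inequality strict after the supremum. *)
Lemma contracting_upper_bohl :
  contracting (nu \o sol (shifted A g) x) -> (upper_bohl nu A x < g%:E)%E.
Proof.
move=> /(contracting_eventually shifted_gt0)[N [q [/andP[q0 q1] qP]]].
apply: (@le_lt_trans _ _ (g + ln q)%:E); last first.
  by rewrite lte_fin gtrDl ln_lt0// q0.
rewrite /upper_bohl; apply: le_trans (_ : ereal_sup [set (growth_rate nu A x p.1 p.2)%:E
    | p in far_apart N] <= _)%E.
  by apply: ereal_inf_lbound; exists N.
apply: ge_ereal_sup => _ [[n m] /= Nnm <-]; rewrite /far_apart /= in Nnm.
have nE : n = (m + (n - m))%N by rewrite subnKC// ltnW// -subn_gt0 (leq_ltn_trans _ Nnm).
rewrite lee_fin nE growth_rate_le ?(leq_ltn_trans _ Nnm)//.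
by rewrite -shifted_le// qP.
Qed.

Lemma expanding_lower_bohl :
  expanding (nu \o sol (shifted A g) x) -> (g%:E < lower_bohl nu A x)%E.
Proof.
move=> /(expanding_eventually shifted_gt0)[N [q [/andP[q0 q1] qP]]].
apply: (@lt_le_trans _ _ (g - ln q)%:E).
  by rewrite lte_fin ltrDl oppr_gt0 ln_lt0// q0.
rewrite /lower_bohl; apply: le_trans (_ : ereal_inf [set (growth_rate nu A x p.1 p.2)%:E
    | p in far_apart N] <= _)%E; last first.
  by apply: ereal_sup_ubound; exists N.
apply: le_ereal_inf_tmp => _ [[n m] /= Nnm <-]; rewrite /far_apart /= in Nnm.
have nE : n = (m + (n - m))%N by rewrite subnKC// ltnW// -subn_gt0 (leq_ltn_trans _ Nnm).
rewrite lee_fin nE growth_rate_ge ?(leq_ltn_trans _ Nnm)//.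
by rewrite -shifted_ge// qP.
Qed.

Variable a : R.
Hypothesis a0 : 0 < a.
Hypothesis Aa : forall n x, nu (A n *m x) <= a * nu x.

Lemma shifted_growth : exists2 b, 1 <= b & forall m h,
  (nu \o sol (shifted A g) x) (m + h)%N <= b ^+ h * (nu \o sol (shifted A g) x) m.
Proof.
exists (1 + expR (- g) * a); first by rewrite lerDl mulr_ge0 ?expR_ge0// ltW.
move=> m h; apply: sol_growth => [|n y].
  by rewrite ltr_pwDl// mulr_ge0 ?expR_ge0// ltW.
rewrite /shifted -scalemxAl norm_scale// ger0_norm ?expR_ge0//.
rewrite mulrDl mul1r -mulrA ler_wpDl ?norm_ge0//.
by rewrite ler_wpM2l ?expR_ge0.
Qed.

Lemma upper_bohl_contracting :
  (upper_bohl nu A x < g%:E)%E -> contracting (nu \o sol (shifted A g) x).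
Proof.
have [b b1 bP] := shifted_growth.
move=> /ereal_inf_lt[_ [N _ <-] Ng].
(* The supremum is an extended real; if it is -oo, any real below [g] serves, here [g - 1]. *)
have [r rg Nr] : exists2 r, r < g &
    (ereal_sup [set (growth_rate nu A x p.1 p.2)%:E | p in far_apart N] <= r%:E)%E.
  move: Ng; case: ereal_sup => [r|//|] Ng; first by exists r.
  by exists (g - 1); rewrite ?leNye// ltrBlDr ltrDl.
have q0 : 0 < expR (r - g) by exact: expR_gt0.
apply: (@eventually_contracting _ _ shifted_gt0 b bP b1 N (expR (r - g))).
  by rewrite q0 expR_lt1 subr_lt0.
move=> m h Nh; rewrite shifted_le// expRK addrC subrK -growth_rate_le.
  rewrite -lee_fin; apply: le_trans Nr; apply: ereal_sup_ubound.
  by exists ((m + h)%N, m) => //=; rewrite /far_apart /= addKn.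
exact: leq_ltn_trans Nh.
Qed.

Lemma lower_bohl_expanding :
  (g%:E < lower_bohl nu A x)%E -> expanding (nu \o sol (shifted A g) x).
Proof.
have [b b1 bP] := shifted_growth.
move=> /ereal_sup_gt[_ [N _ <-] Ng].
have [r rg Nr] : exists2 r, g < r &
    (r%:E <= ereal_inf [set (growth_rate nu A x p.1 p.2)%:E | p in far_apart N])%E.
  move: Ng; case: ereal_inf => [r| |//] Ng; first by exists r.
  by exists (g + 1); rewrite ?leey// ltrDl.
have q0 : 0 < expR (g - r) by exact: expR_gt0.
apply: (@eventually_expanding _ _ shifted_gt0 b bP b1 N (expR (g - r))).
  by rewrite q0 expR_lt1 subr_lt0.
move=> m h Nh; rewrite shifted_ge// expRK opprB addrC subrK -growth_rate_ge.
  rewrite -lee_fin; apply: le_trans Nr _; apply: ereal_inf_lbound.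
  by exists ((m + h)%N, m) => //=; rewrite /far_apart /= addKn.
exact: leq_ltn_trans Nh.
Qed.

Lemma bohl_interval_dichotomy :
  contracting (nu \o sol (shifted A g) x) \/ expanding (nu \o sol (shifted A g) x) <->
  ~ (lower_bohl nu A x <= g%:E <= upper_bohl nu A x)%E.
Proof.
split=> [[/contracting_upper_bohl ug|/expanding_lower_bohl gl]|].
- by rewrite [(g%:E <= _)%E]leNgt ug andbF.
- by rewrite [(_ <= g%:E)%E]leNgt gl.
move=> /negP; rewrite negb_and -!ltNge => /orP[gl|ug].
  by right; exact: lower_bohl_expanding.
by left; exact: upper_bohl_contracting.
Qed.

End BohlExponents.

(** * Spectra *)

Lemma shifted_unit (R : realType) (d : nat) (A : nat -> 'M[R]_d) g n :
  A n \in unitmx -> shifted A g n \in unitmx.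
Proof. by move=> Au; rewrite /shifted unitmxZ// unitfE gt_eqF// expR_gt0. Qed.

Section Spectra.

Variables (R : realType) (d : nat) (nu : 'cV[R]_d -> R).
Hypothesis nuP : is_norm nu.
Variable A : nat -> 'M[R]_d.
Hypothesis Au : forall n, A n \in unitmx.
Variable M : R.
Hypotheses (M0 : 0 <= M) (AM : forall n i j, `|A n i j| <= M).

Lemma bohl_spectrum_sub : bohl_spectrum nu A `<=` bohl_dichotomy_spectrum nu A.
Proof.
move=> g [x x0 gx] BD; have [a a0 aP] := norm_mulmx_le nuP M0.
move: gx; apply/(bohl_interval_dichotomy nuP Au x0 _ a0 (fun n => aP _ (AM n))).
by apply: bohl_dichotomy_solution => // n; exact: shifted_unit.
Qed.

Lemma bohl_dichotomy_spectrum_sub :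
  bohl_dichotomy_spectrum nu A `<=` exponential_dichotomy_spectrum nu A.
Proof. by move=> g nBD /exponential_bohl_dichotomy. Qed.

Hypothesis AT : upper_triangular A.

(** The right-hand side involves the diagonal only, so [A] and [diag_part A] have the same
    exponential dichotomy spectrum. *)
Lemma exponential_dichotomy_shiftedP g :
  exponential_dichotomy nu (shifted A g) <->
  forall i, scalar_dichotomy (fun n => expR (- g) * A n i i).
Proof.
have gM : 0 <= expR (- g) * M by rewrite mulr_ge0 ?expR_ge0.
have Bu n : shifted A g n \in unitmx by exact: shifted_unit.
have BT : upper_triangular (shifted A g).
  by move=> n i j ij; rewrite mxE AT// mulr0.
have BM n i j : `|shifted A g n i j| <= expR (- g) * M.
  by rewrite mxE normrM ger0_norm ?expR_ge0// ler_wpM2l ?expR_ge0.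
have BE i : (fun n => expR (- g) * A n i i) = (fun n => shifted A g n i i).
  by apply/funext => n; rewrite mxE.
split=> [ED i|BD].
  by rewrite BE; exact: (exponential_dichotomy_diagonal nuP Bu BT gM BM ED).
apply: (diagonal_exponential_dichotomy nuP Bu BT BM) => i.
by rewrite -BE.
Qed.

(** For invariant coordinate axes the diagonal equations are solutions of the system, to which being
    outside the Bohl spectrum applies. *)
Lemma axes_bohl_spectrum g :
  (forall i n, A n *m delta_mx i 0 = A n i i *: (delta_mx i 0 : 'cV[R]_d)) ->
  ~ bohl_spectrum nu A g ->
  forall i, scalar_dichotomy (fun n => expR (- g) * A n i i).
Proof.
move=> Ai gA i; have [a a0 aP] := norm_mulmx_le nuP M0.
apply: (@eigenvector_dichotomy _ _ _ nuP (shifted A g) _ (delta_mx i 0)).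
- exact: delta_col_neq0.
- by move=> n; rewrite /shifted -scalemxAl Ai scalerA.
have i0 := @delta_col_neq0 R d i.
apply/(bohl_interval_dichotomy nuP Au i0 _ a0 (fun n => aP _ (AM n))) => gi.
by apply: gA; exists (delta_mx i 0).
Qed.

End Spectra.

Section DiagonalPart.

Variables (R : realType) (d : nat) (A : nat -> 'M[R]_d).

Lemma diag_partE n i j : diag_part A n i j = A n i i *+ (i == j).
Proof.
by rewrite !mxE; case: eqP => // ->.
Qed.

Lemma diag_part_triangular : upper_triangular (diag_part A).
Proof. by move=> n i j ji; rewrite diag_partE -val_eqE gtn_eqF. Qed.

Lemma diag_part_axis i n :
  diag_part A n *m delta_mx i 0 = diag_part A n i i *: (delta_mx i 0 : 'cV[R]_d).
Proof.
rewrite -colE; apply/matrixP => k j; rewrite mxE [RHS]mxE !diag_partE eqxx mxE.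
by rewrite ord1 eqxx andbT; case: eqP => [->|_]; rewrite ?mulr1 ?mulr0.
Qed.

End DiagonalPart.

Lemma bounded_entries (R : realType) (d : nat) (A : nat -> 'M[R]_d) :
  bounded_fun A -> exists2 M : R, 0 <= M & forall n i j, `|A n i j| <= M.
Proof.
move=> [M [_ MP]]; exists (`|M| + 1) => [|n i j]; first by rewrite addr_ge0.
rewrite (le_trans (entry_le_mx_norm _ _ _))//; apply: MP => //.
by rewrite (le_lt_trans (ler_norm M))// ltrDl.
Qed.

Theorem theorem34 (R : realType) (d : nat) (hd : (0 < d)%N)
    (nu : 'cV[R]_d -> R) (hnu : is_norm nu)
    (A : nat -> 'M[R]_d) (hA : lyapunov_sequence A)
    (hT : upper_triangular A) :
  ((bohl_spectrum nu A `<=` bohl_dichotomy_spectrum nu A) /\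
   (bohl_dichotomy_spectrum nu A `<=` exponential_dichotomy_spectrum nu A)) /\
  (bohl_spectrum nu (diag_part A) =
     bohl_dichotomy_spectrum nu (diag_part A) /\
   bohl_dichotomy_spectrum nu (diag_part A) =
     exponential_dichotomy_spectrum nu (diag_part A)) /\
  [/\ bohl_spectrum nu A `<=` bohl_spectrum nu (diag_part A),
      bohl_dichotomy_spectrum nu A
        `<=` bohl_dichotomy_spectrum nu (diag_part A)
    & exponential_dichotomy_spectrum nu A =
        exponential_dichotomy_spectrum nu (diag_part A)].

Proof.
case: hA => Au /bounded_entries[M M0 AM] _.
set D := diag_part A.
have DT : upper_triangular D := diag_part_triangular A.
have DA n i : D n i i = A n i i by rewrite diag_partE eqxx.
have Du n : D n \in unitmx.
  apply/upper_triangular_unitP => // i; rewrite DA.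
  exact: (upper_triangular_unitP _ hT (Au n)).
have DM n i j : `|D n i j| <= M.
  rewrite diag_partE; case: eqP => _; first exact: AM.
  by rewrite normr0.
have AB := bohl_spectrum_sub hnu Au M0 AM.
have ABE := @bohl_dichotomy_spectrum_sub _ _ nu A.
have DB := bohl_spectrum_sub hnu Du M0 DM.
have DBE := @bohl_dichotomy_spectrum_sub _ _ nu D.
have DAg g i : (fun n => expR (- g) * D n i i) = (fun n => expR (- g) * A n i i).
  by apply/funext => n; rewrite DA.
have EAD : exponential_dichotomy_spectrum nu A = exponential_dichotomy_spectrum nu D.
  have AP := exponential_dichotomy_shiftedP hnu Au M0 AM hT.
  have DP := exponential_dichotomy_shiftedP hnu Du M0 DM DT.
  apply/seteqP; split=> g gE gE'; apply: gE.
    by apply/AP => i; have /DP/(_ i) := gE'; rewrite DAg.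
  by apply/DP => i; have /AP/(_ i) := gE'; rewrite DAg.
(* Closes the cycle of inclusions for [D]; the inclusions for [A] then pass through the common
   exponential dichotomy spectrum. *)
have DEB : exponential_dichotomy_spectrum nu D `<=` bohl_spectrum nu D.
  move=> g gE; apply: contrapT => gB; apply: gE.
  apply/(exponential_dichotomy_shiftedP hnu Du M0 DM DT).
  exact: (axes_bohl_spectrum hnu Du M0 DM (@diag_part_axis _ _ A) gB).
split; [by split | split; [split | split]].
- by apply/seteqP; split=> // g /DBE/DEB.
- by apply/seteqP; split=> // g /DEB/DB.
- by move=> g /AB/ABE; rewrite EAD => /DEB.
- by move=> g /ABE; rewrite EAD => /DEB/DB.
- exact: EAD.
Qed.
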